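(* Suppose that for every fixed $\lambda_3>0$, Hypothesis T holds with this $\lambda_3$ and with $\tau_v=v^{-O(v)}$. Then for every fixed $\epsilon>0$ there exist positive constants $c$, $c_1$, $C$ (depending on $\epsilon$) such that the following holds. Let $x\ge2$ be real, let $\mathcal{P}$ be a subset of the primes $\le x$, and let $\mathcal{E}=\{p\le x:\ p\text{ prime},\ p\notin\mathcal{P}\}$. If there is some real $v>0$ with $v\le c\sqrt{\log x}$ and $$\sum_{\substack{p\in\mathcal{P}\\ x^{1/(ev)}<p\le x}}\frac1p\ \ge\ 1+\epsilon,$$ then $$\frac{\Psi(x;\mathcal{P})}{x}\ \ge\ A_v\prod_{p\in\mathcal{E}}\left(1-\frac1p\right)\qquad\text{with } A_v=c_1v^{-Cv}.$$
   Context: $\Psi(x;\mathcal{P})$ denotes the number of positive integers $n\le x$ all of whose prime factors lie in $\mathcal{P}$. Here $e$ is the base of the natural logarithm. Hypothesis T (with constant $\lambda_3>0$ and a function $\tau_v>0$ of $v\ge1$): whenever $1\le u\le v$ are real and $T$ is an open subset of $(\frac1{ev},\frac1u)$ with $\int_{t\in T}\frac{dt}{t}\ge\frac{1+\lambda_3}{u}$, there exists an integer $k\in[u,ev]$ such that $$\int\cdots\int_{\substack{t_1+\cdots+t_k=1\\ t_1,\dots,t_k\in T}}\frac{dt_1\cdots dt_{k-1}}{t_1t_2\cdots t_k}\ \ge\ \tau_v\left(\int_{t\in T}\frac{dt}{t}\right)^k .$$ The integral on the left is over those $(t_1,\dots,t_{k-1})\in T^{k-1}$ for which $t_k:=1-(t_1+\cdots+t_{k-1})$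 lies in $T$. ''$\tau_v=v^{-O(v)}$'' means that there are positive constants $c_0,C_0$ (which may depend on $\lambda_3$) such that one may take $\tau_v\ge c_0v^{-C_0v}$ for all $v\ge1$. *)

(* Defs.v *)
From HB Require Import structures.
From mathcomp Require Import all_boot all_order all_algebra.
From mathcomp Require Import all_classical all_reals all_analysis.
Import Order.TTheory GRing.Theory Num.Theory.
Import numFieldNormedType.Exports.

Set Implicit Arguments.
Unset Strict Implicit.
Unset Printing Implicit Defensive.

Local Open Scope classical_set_scope.
Local Open Scope ring_scope.

(* The m-fold Lebesgue integral of f(t_1, ..., t_m) over D^m, a point of D^m
   being the list [:: t_1; ...; t_m].  It is an iterated integral; for the
   nonnegative Borel integrands used below this is, by Tonelli, the integral
   against m-dimensional Lebesgue measure.  For m = 0 it is the value of f at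
   the unique point of D^0. *)
Fixpoint multi_integral (R : realType) (D : set R) (m : nat)
    (f : seq R -> \bar R) : \bar R :=
  if m is m'.+1 then
    (\int[lebesgue_measure]_(t in D)
       multi_integral D m' (fun s => f (t :: s)))%E
  else f [::].

(* s lists t_1, ..., t_(k-1); the condition t_k \in T of the domain of
   integration is expressed by extending the integrand by 0. *)
Definition simplex_integrand (R : realType) (T : set R) (s : seq R) : \bar R :=
  let tk := 1 - \sum_(t <- s) t in
  if tk \in T then (((\prod_(t <- s) t) * tk)^-1)%:E else 0%E.

Definition simplex_integral (R : realType) (T : set R) (k : nat) : \bar R :=
  multi_integral T k.-1 (simplex_integrand T).

Definition log_measure (R : realType) (T : set R) : \bar R :=
  (\int[lebesgue_measure]_(t in T) (t^-1)%:E)%E.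

Definition hypothesisT (R : realType) (lambda3 : R) (tau : R -> R) : Prop :=
  (forall v : R, 1 <= v -> 0 < tau v) /\
  forall (u v : R) (T : set R), 1 <= u -> u <= v ->
    open T -> T `<=` `](expR 1 * v)^-1, u^-1[ ->
    (((1 + lambda3) / u)%:E <= log_measure T)%E ->
    exists k : nat, [/\ u <= k%:R, k%:R <= expR 1 * v &
      ((tau v)%:E * log_measure T ^+ k <= simplex_integral T k)%E].

(* tau_v = v^(-O(v)) *)
Definition v_pow_negOv (R : realType) (tau : R -> R) : Prop :=
  exists c0 C0 : R, [/\ 0 < c0, 0 < C0 &
    forall v : R, 1 <= v -> c0 * v `^ (- (C0 * v)) <= tau v].

(* P.-nat n means that n > 0 and every prime divisor of n is in P. *)
Definition Psi (R : realType) (x : R) (P : nat_pred) : nat :=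
  count P.-nat (iota 1 (Num.truncn x)).

Definition excluded_primes (R : realType) (x : R) (P : nat_pred) : nat_pred :=
  [pred p : nat | [&& prime p, p%:R <= x & p \notin P]].

(* Main.v *)
(* Cut the primes into cells [e^(K j), e^(K (j+1))) with K a large constant, and
   put W = e v.  By Mertens' theorem the primes of the j-th cell have reciprocal
   sum at most (1 + O(1/K)) / j, so the cells of (x^(1/W), x] carrying a
   proportion at least eta, of order 1/W, of their expected mass from P still
   satisfy sum_j 1/j >= 1 + eps/2.  Let X = x / (m e^(K W)), where
   m <= x^(delta/W) is composed of primes of P.  Rescaled by 1/ln X, the good
   cells form a set T to which Hypothesis T applies with u = 1.  On a product of
   cells the integrand is comparable to a constant, so the lower bound for the
   integral bounds from below the number of k-tuples of primes of P in good
   cells whose product is within a factor e^(K k) of X.  This gives at least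
   v^(-O(v)) x / (m ln x) integers n <= x / m composed of large primes of P.
   The products m n are distinct, and the sum of 1/m over the admissible m is at
   least (delta ln x / W) prod_(p in E) (1 - 1/p), as is seen by removing the
   primes of E one at a time from the harmonic sum. *)

Require Import Defs.
From HB Require Import structures.
From mathcomp Require Import all_boot all_order all_algebra.
From mathcomp Require Import all_classical all_reals all_analysis
  measurable_realfun.
From mathcomp Require Import ring lra zify.
Import Order.TTheory GRing.Theory Num.Theory.
Import numFieldNormedType.Exports.

Set Implicit Arguments.
Unset Strict Implicit.
Unset Printing Implicit Defensive.

Local Open Scope classical_set_scope.
Local Open Scope ring_scope.

(** * Mertens' first theorem *)

Lemma ln_nat_ge0 (R : realType) (n : nat) : 0 <= ln (n%:R : R).
Proof. by case: n => [|n]; [rewrite ln0 | rewrite ln_ge0 // ler1n]. Qed.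

Lemma ln_prod (R : realType) (I : Type) (s : seq I) (P : pred I) (F : I -> R) :
  (forall i, P i -> 0 < F i) ->
  ln (\prod_(i <- s | P i) F i) = \sum_(i <- s | P i) ln (F i).
Proof.
move=> F0; elim: s => [|i s IHs]; first by rewrite !big_nil ln1.
rewrite !big_cons; case: ifP => // Pi.
by rewrite lnM ?IHs // posrE ?F0 // prodr_gt0.
Qed.

Lemma ln_logn_sum (R : realType) (N m : nat) :
  (0 < m)%N -> (forall p, prime p -> (p %| m)%N -> (p <= N)%N) ->
  ln (m%:R : R) =
    \sum_(0 <= p < N.+1 | prime p) (logn p m)%:R * ln (p%:R : R).
Proof.
move=> m0 mN; have lM : (m <= maxn N m)%N by rewrite leq_maxr.
rewrite -{1}(partnT m0) (widen_partn _ lM) natr_prod.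
rewrite (bigID prime) /= [X in _ * X]big1 ?mulr1; last first.
  by move=> p; rewrite lognE => /negPf->; rewrite expn0.
rewrite ln_prod => [|p pp]; last by rewrite ltr0n expn_gt0 prime_gt0.
rewrite (big_cat_nat (n := N.+1)) //=; last by rewrite ltnS leq_maxl.
rewrite [X in _ + X]big_nat_cond [X in _ + X]big1 ?addr0; last first.
  move=> p /andP[/andP[Np _] pp]; rewrite lognE pp m0 /=.
  by case: ifP => [/(mN _ pp)|]; [rewrite leqNgt Np | rewrite expn0 ln1].
by apply: eq_bigr => p pp; rewrite natrX lnXn ?ltr0n ?prime_gt0 // mulr_natl.
Qed.

Lemma ln_fact_le (R : realType) (n : nat) :
  ln (n`!%:R : R) <= n%:R * ln (n%:R : R).
Proof.
elim: n => [|n IHn]; first by rewrite fact0 ln1 mul0r.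
rewrite factS natrM lnM ?posrE ?ltr0n ?fact_gt0 //.
apply: (@le_trans _ _ (ln (n.+1%:R : R) + n%:R * ln (n%:R : R))).
  by rewrite lerD2l.
rewrite -[X in _ <= X * _]natr1 mulrDl mul1r addrC lerD2r.
case: n {IHn} => [|n]; first by rewrite !mul0r.
by rewrite ler_wpM2l // ler_ln ?posrE ?ltr0n // ler_nat.
Qed.

Lemma ln_succ_le (R : realType) (n : nat) : (0 < n)%N ->
  ln (n.+1%:R : R) <= ln (n%:R : R) + n%:R^-1.
Proof.
move=> n0; have n0R : (0 : R) < n%:R by rewrite ltr0n.
have -> : (n.+1%:R : R) = n%:R * (1 + n%:R^-1).
  by rewrite mulrDr mulr1 mulfV ?gt_eqF // natr1.
have i0 : (0 : R) < n%:R^-1 by rewrite invr_gt0.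
rewrite lnM ?posrE ?addr_gt0 // lerD2l le_ln1Dx //.
by apply: lt_trans i0; rewrite ltrN10.
Qed.

(** The lower half of Stirling's formula; the induction step is n ln(1 + 1/n) <= 1. *)
Lemma ln_fact_ge (R : realType) (n : nat) :
  n%:R * ln (n%:R : R) - n%:R <= ln (n`!%:R : R).
Proof.
elim: n => [|n IHn]; first by rewrite fact0 ln1 mul0r subr0.
rewrite factS natrM lnM ?posrE ?ltr0n ?fact_gt0 //.
have H : n%:R * ln (n.+1%:R : R) <= n%:R * ln (n%:R : R) + 1.
  case: n {IHn} => [|n]; first by rewrite !mul0r add0r.
  have := @ln_succ_le R n.+1 isT.
  have n0 : (0 : R) < n.+1%:R by rewrite ltr0n.
  by rewrite -(ler_pM2l n0) mulrDr mulfV // gt_eqF.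
have E : (n.+1%:R : R) = n%:R + 1 by rewrite natr1.
by set l := ln _ in H *; rewrite E; lra.
Qed.

Lemma bin_double_le (n : nat) : ('C(n.*2, n) <= 4 ^ n)%N.
Proof.
have -> : (4 ^ n = (1 + 1) ^ n.*2)%N by rewrite -mul2n expnM.
rewrite expnDn (bigD1 (inord n)) //= inordK ?ltnS; last by lia.
by rewrite !exp1n !muln1 leq_addr.
Qed.

Lemma prime_dvd_fact (n p : nat) : prime p -> (p %| n`!)%N -> (p <= n)%N.
Proof.
move=> pp; elim: n => [|n IHn].
  by rewrite fact0 => /dvdn_leq -/(_ isT); rewrite leqNgt prime_gt1.
rewrite factS Euclid_dvdM // => /orP[/dvdn_leq -> //|/IHn]; exact: leqW.
Qed.

(** Such a p divides (2n)! = C(2n, n) n! n! but does not divide n!. *)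
Lemma prime_dvd_bin_double (n p : nat) : prime p -> (n < p <= n.*2)%N ->
  (0 < logn p 'C(n.*2, n))%N.
Proof.
move=> pp /andP[np p2]; rewrite logn_gt0 mem_primes pp bin_gt0.
have -> /= : (n <= n.*2)%N by lia.
have := @bin_fact n.*2 n; rewrite -addnn leq_addr addnK => /(_ isT) E.
have : (p %| (n + n)`!)%N by rewrite dvdn_fact // prime_gt0 // addnn.
rewrite -E !Euclid_dvdM //.
have /negPf-> : ~~ (p %| n`!)%N; last by rewrite !orbF.
by apply/negP => /(prime_dvd_fact pp); rewrite leqNgt np.
Qed.

(** All primes in (n, 2n] divide C(2n, n), which is at most 4^n. *)
Lemma chebyshev_double (R : realType) (n : nat) :
  \sum_(n.+1 <= p < n.*2.+1 | prime p) ln (p%:R : R) <= n%:R * ln 4.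
Proof.
apply: (@le_trans _ _ (ln ('C(n.*2, n)%:R : R))).
  rewrite (@ln_logn_sum _ n.*2) ?bin_gt0; last 2 first.
  - by lia.
  - move=> p pp /dvdn_trans pC; apply: prime_dvd_fact => //; apply: pC.
    by rewrite -(@bin_fact n.*2 n) ?dvdn_mulr //; lia.
  rewrite [leRHS](big_cat_nat (n := n.+1)) //=; last by lia.
  rewrite -[leLHS]add0r lerD //.
    by apply: sumr_ge0 => p _; rewrite mulr_ge0 // ln_nat_ge0.
  rewrite big_nat_cond [leRHS]big_nat_cond; apply: ler_sum => p.
  move=> /andP[pn pp]; rewrite -[leLHS]mul1r ler_wpM2r ?ln_nat_ge0 //.
  by rewrite ler1n prime_dvd_bin_double.
rewrite mulr_natl -lnXn // -natrX ler_ln ?posrE ?ltr0n ?bin_gt0 ?expn_gt0 //.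
  by rewrite ler_nat bin_double_le.
by lia.
Qed.

(** Let theta(n) be the left-hand side and h = ceil(n/2). Then theta(n) <= theta(2h) <= theta(h) + h
    ln 4, and the constant 3 closes the induction because 3h + h <= 3n once n >= 2. *)
Lemma chebyshev_theta (R : realType) (n : nat) :
  \sum_(0 <= p < n.+1 | prime p) ln (p%:R : R) <= 3 * ln 4 * n%:R.
Proof.
have l4 : 0 < ln (4 : R) by rewrite ln_gt0 // ltr1n.
elim/ltn_ind: n => -[_|[_|n IHn]].
- by rewrite mulr0 big1_seq // => -[|p] /andP[pp]; rewrite mem_index_iota.
- rewrite big1_seq ?mulr1 ?mulr_ge0 // ?ltW // => p /andP[pp].
  by rewrite mem_index_iota; case: p pp => [|[]].
set m := n.+2; set h := uphalf m.
have hm : (h < m)%N by rewrite /h /m; lia.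
have mh : (m <= h.*2)%N by rewrite /h /m; lia.
apply: (@le_trans _ _ (\sum_(0 <= p < h.*2.+1 | prime p) ln (p%:R : R))).
  rewrite [leRHS](big_cat_nat (n := m.+1)) //= lerDl.
  by apply: sumr_ge0 => p _; rewrite ln_nat_ge0.
rewrite (big_cat_nat (n := h.+1)) //=; last by lia.
apply: (le_trans (lerD (IHn _ hm) (chebyshev_double R h))).
have -> : 3 * ln 4 * h%:R + h%:R * ln 4 = ln 4 * (4 * h)%N%:R :> R.
  by rewrite natrM; ring.
have -> : 3 * ln 4 * m%:R = ln 4 * (3 * m)%N%:R :> R by rewrite natrM; ring.
by apply: ler_wpM2l; [exact: ltW | rewrite ler_nat /h /m; lia].
Qed.

(** The first term of Legendre's formula gives n/p <= v_p(n!) + 1, so n times the sum is at most ln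
    n! plus Chebyshev's sum. *)
Lemma mertens1_upper (R : realType) (n : nat) : (0 < n)%N ->
  \sum_(0 <= p < n.+1 | prime p) ln (p%:R : R) / p%:R
    <= ln n%:R + 3 * ln 4.
Proof.
move=> n0; have n0R : (0 : R) < n%:R by rewrite ltr0n.
rewrite -(ler_pM2l n0R) mulrDr.
apply: (@le_trans _ _ (ln (n`!%:R : R) +
    \sum_(0 <= p < n.+1 | prime p) ln (p%:R : R))); last first.
  rewrite lerD ?ln_fact_le // (le_trans (chebyshev_theta R n)) //.
  by rewrite mulrC.
rewrite (@ln_logn_sum _ n) ?fact_gt0 //; last by move=> *;
  exact: prime_dvd_fact.
rewrite -big_split /= mulr_sumr; apply: ler_sum => p pp.
rewrite mulrCA -[X in _ <= _ + X]mul1r -mulrDl mulrC ler_wpM2r ?ln_nat_ge0 //.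
have p0 : (0 : R) < p%:R by rewrite ltr0n prime_gt0.
rewrite ler_pdivrMr // natr1 -natrM ler_nat logn_fact // big_ltn //.
by rewrite expn1; have := ltn_ceil n (prime_gt0 pp); nia.
Qed.

(* The terms are at most f(p - 1) - f(p) where f(n) = (ln n + 2) / n. *)
Lemma sum_ln_sq_le (R : realType) (n : nat) :
  \sum_(2 <= p < n.+2) ln (p%:R : R) / (p%:R * (p%:R - 1))
    <= 2 - (ln n.+1%:R + 2) / n.+1%:R.
Proof.
elim: n => [|n IHn]; first by rewrite big_geq // ln1 add0r divr1 subrr.
rewrite big_nat_recr //= (le_trans (lerD IHn (lexx _))) //.
have := @ln_succ_le R n.+1 isT; set a := ln n.+1%:R; set b := ln n.+2%:R.
have -> : (n.+2%:R : R) = n.+1%:R + 1 by rewrite natr1.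
have : (1 : R) <= n.+1%:R by rewrite ler1n.
set t : R := n.+1%:R => t1 H; clear IHn; clearbody a b t.
have t0 : 0 < t by lra.
have u0 : 0 < t + 1 by lra.
rewrite -subr_ge0.
have -> : 2 - (b + 2) / (t + 1) - (2 - (a + 2) / t + b / ((t + 1) * (t
  + 1 - 1)))
  = ((t + 1) * (a - b) + 2) / (t * (t + 1)).
  by field; rewrite !gt_eqF //; lra.
apply: divr_ge0; last by rewrite mulr_ge0 // ltW.
have : (t + 1) * (b - a) <= (t + 1) * t^-1 by rewrite ler_pM2l // lerBlDl.
have : t^-1 <= 1 by rewrite invf_le1.
have -> : (t + 1) * t^-1 = 1 + t^-1 by field; rewrite gt_eqF.
lra.
Qed.

(** Dropping the floors in Legendre's formula leaves a geometric series. *)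
Lemma logn_fact_le (R : realType) (n p : nat) : prime p ->
  (logn p n`!)%:R <= n%:R / (p%:R - 1) :> R.
Proof.
move=> pp; have p1 : (1 : R) < p%:R by rewrite ltr1n prime_gt1.
have p0 : (0 : R) < p%:R by lra.
have H m : \sum_(1 <= k < m.+1) (p%:R :
  R)^-1 ^+ k = (1 - p%:R^-1 ^+ m) / (p%:R - 1).
  elim: m => [|m IHm]; first by rewrite big_geq // expr0 subrr mul0r.
  rewrite big_nat_recr //= IHm exprS; set y := _ ^+ m.
  by field; rewrite !gt_eqF //; lra.
rewrite logn_fact // natr_sum.
apply: (@le_trans _ _ (n%:R * \sum_(1 <= k < n.+1) (p%:R : R)^-1 ^+ k)).
  rewrite mulr_sumr; apply: ler_sum => k _; rewrite exprVn -natrX.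
  by rewrite ler_pdivlMr ?ltr0n ?expn_gt0 ?prime_gt0 // -natrM ler_nat leq_divM.
have q0 : 0 <= (p%:R - 1 : R)^-1 by rewrite invr_ge0; lra.
rewrite H mulrA ler_wpM2r // ler_piMr // gerBl exprn_ge0 // invr_ge0; lra.
Qed.

(** Since 1/(p - 1) = 1/p + 1/(p(p - 1)), ln n! is at most n times the sum plus 2n. The constant 3
    is this 2 plus the 1 lost in Stirling's bound. *)
Lemma mertens1_lower (R : realType) (n : nat) : (0 < n)%N ->
  ln n%:R - 3 <= \sum_(0 <= p < n.+1 | prime p) ln (p%:R : R) / p%:R.
Proof.
move=> n0; have n0R : (0 : R) < n%:R by rewrite ltr0n.
have S : \sum_(0 <= p < n.+1 | prime p) ln (p%:R :
  R) / (p%:R * (p%:R - 1)) <= 2.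
  have := sum_ln_sq_le R n.-1; rewrite prednK // => H.
  apply: (@le_trans _ _ (\sum_(2 <= p < n.+1) ln (p%:R :
    R) / (p%:R * (p%:R - 1)))).
    rewrite (big_cat_nat (n := 2)) //= [X in X + _]big1_seq ?add0r; last first.
      by move=> p /andP[pp]; rewrite mem_index_iota; case: p pp => [|[]].
    rewrite big_mkcond [leRHS]big_nat_cond [leLHS]big_nat_cond;
      apply: ler_sum => p /andP[/andP[p2 _] _].
    case: ifP => // _; rewrite mulr_ge0 ?ln_nat_ge0 // invr_ge0 mulr_ge0 //.
    by rewrite subr_ge0 ler1n ltnW.
  have q0 : 0 <= (ln (n%:R : R) + 2) / n%:R.
    by rewrite divr_ge0 // addr_ge0 // ln_nat_ge0.
  by rewrite (le_trans H) // gerBl.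
have : ln (n`!%:R : R) <= n%:R * (\sum_(0 <= p < n.+1 | prime p) ln (p%:R :
  R) / p%:R + 2).
  rewrite (@ln_logn_sum _ n) ?fact_gt0 //; last by move=> *;
    exact: prime_dvd_fact.
  apply: (@le_trans _ _ (n%:R * (\sum_(0 <= p < n.+1 | prime p)
     (ln (p%:R : R) / p%:R + ln (p%:R : R) / (p%:R * (p%:R - 1))))));
       last first.
    by rewrite ler_pM2l // big_split /=; apply: lerD.
  rewrite mulr_sumr; apply: ler_sum => p pp.
  have p1 : (1 : R) < p%:R by rewrite ltr1n prime_gt1.
  apply: (le_trans (ler_wpM2r (ln_nat_ge0 R p) (@logn_fact_le R n p pp))).
  rewrite le_eqVlt; apply/orP; left; apply/eqP; field; rewrite !gt_eqF //; lra.
move=> /(le_trans (ln_fact_ge R n)).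
have -> : n%:R * ln n%:R - n%:R = n%:R * (ln n%:R - 1) :> R by ring.
by rewrite ler_pM2l //; lra.
Qed.

Lemma ler_sum_uniq (R : numDomainType) (I : eqType) (r s : seq I)
    (P Q : pred I) (F : I -> R) :
  uniq r -> uniq s -> (forall i, i \in s -> Q i -> 0 <= F i) ->
  (forall i, i \in r -> P i -> (i \in s) && Q i) ->
  \sum_(i <- r | P i) F i <= \sum_(i <- s | Q i) F i.
Proof.
move=> ur us F0 sub; rewrite [leRHS](bigID (fun i => i \in [seq j <- r | P j])).
have -> : \sum_(i <- s | Q i && (i \in [seq j <- r | P j])) F i
    = \sum_(i <- r | P i) F i.
  rewrite -big_filter -[RHS]big_filter; apply: perm_big.
  apply: uniq_perm; rewrite ?filter_uniq // => i; rewrite !mem_filter.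
  apply/idP/idP => [/andP[/andP[_ ->]] //|/andP[Pi ri]].
  by have /andP[-> ->] := sub _ ri Pi; rewrite Pi ri.
by rewrite lerDl big_seq_cond sumr_ge0 // => i /and3P[si Qi _]; apply: F0.
Qed.

(** The total error of Mertens' theorem on an interval: 3 ln 4 from the upper bound, 3 from the
    lower bound, 1 for the prime at the lower end and 1 for rounding e^a down to an integer. *)
Definition mertens_const (R : realType) : R := 3 * ln 4 + 5.

Lemma mertens_const_gt0 (R : realType) : 0 < mertens_const R.
Proof. by rewrite addr_gt0 // mulr_gt0 // ln_gt0 // ltr1n. Qed.

Lemma mertens1_interval (R : realType) (a b : R) (N : nat) : 0 <= a <= b ->
  \sum_(0 <= p < N | prime p && (a <= ln (p%:R : R) <= b)) ln (p%:R : R) / p%:R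
    <= b - a + mertens_const R.
Proof.
move=> /andP[a0 ab]; set n1 := Num.truncn (expR a);
  set n2 := Num.truncn (expR b).
have ea1 : 1 <= expR a by rewrite (le_trans _ (expR_ge1Dx a)) // lerDl.
have n1_gt0 : (0 < n1)%N by rewrite truncn_gt0.
have n12 : (n1 <= n2)%N by rewrite le_truncn // ler_expR.
have n2_gt0 : (0 < n2)%N := leq_trans n1_gt0 n12.
pose A n := \sum_(0 <= p < n.+1 | prime p) ln (p%:R : R) / p%:R.
have H1 : \sum_(0 <= p < N | prime p && (a <= ln (p%:R : R) <= b)) ln (p%:R :
  R) / p%:R
   <= \sum_(n1 <= p < n2.+1 | prime p) ln (p%:R : R) / p%:R.
  apply: ler_sum_uniq; rewrite ?iota_uniq //.
    by move=> i _ _; rewrite divr_ge0 // ln_nat_ge0.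
  move=> p _ /andP[pp /andP[ap pb]]; rewrite pp andbT mem_index_iota ltnS.
  have p0 : (0 : R) < p%:R by rewrite ltr0n prime_gt0.
  rewrite truncn_ge_nat ?expR_ge0 // -[p%:R]lnK // ler_expR pb andbT.
  rewrite -(ler_nat R) (le_trans (_ : _ <= expR a)) ?truncn_le ?expR_ge0 //.
  by rewrite -[p%:R]lnK // ler_expR.
(* The sum on the left includes p = n1, which [A n1] also counts; that single term is at most 1. *)
have H2 : \sum_(n1 <= p < n2.+1 | prime p) ln (p%:R :
  R) / p%:R <= A n2 - A n1 + 1.
  have E2 : A n2 = \sum_(0 <= p < n1 | prime p) ln (p%:R : R) / p%:R
      + \sum_(n1 <= p < n2.+1 | prime p) ln (p%:R : R) / p%:R.
    by rewrite /A (big_cat_nat (n := n1)) //= leqW.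
  have E1 : A n1 = \sum_(0 <= p < n1 | prime p) ln (p%:R : R) / p%:R
      + (if prime n1 then ln (n1%:R : R) / n1%:R else 0).
    by rewrite /A big_mkcond big_nat_recr //= -big_mkcond.
  suff : (if prime n1 then ln (n1%:R : R) / n1%:R else 0) <= 1 by lra.
  case: ifP => // _; rewrite ler_pdivrMr ?ltr0n // mul1r ltW //.
  by rewrite ln_sublinear // ltr0n.
have U : A n2 <= ln n2%:R + 3 * ln 4 := mertens1_upper R n2_gt0.
have L : ln n1%:R - 3 <= A n1 := mertens1_lower R n1_gt0.
have bb : ln (n2%:R : R) <= b.
  by rewrite -[b]expRK ler_ln ?posrE ?ltr0n ?expR_gt0 // truncn_le expR_ge0.
have aa : a <= ln (n1%:R : R) + 1.
  apply: (@le_trans _ _ (ln (n1.+1%:R : R))).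
    by rewrite -[a]expRK ler_ln ?posrE ?expR_gt0 // ltW // truncnS_gt.
  by rewrite (le_trans (ln_succ_le R n1_gt0)) // lerD2l invf_le1 ?ltr0n //
    ler1n.
rewrite /mertens_const; lra.
Qed.

(** * Primes in cells of length K on the logarithmic scale *)

Definition cell (R : realType) (K : R) (p : nat) :
  nat := Num.truncn (ln p%:R / K).

Lemma cell_itv (R : realType) (K : R) (p : nat) : 0 < K ->
  K * (cell K p)%:R <= ln p%:R < K * (cell K p).+1%:R.
Proof.
move=> K0; have x0 : 0 <= ln (p%:R : R) / K
  by rewrite divr_ge0 ?ln_nat_ge0 // ltW.
rewrite mulrC -ler_pdivlMr // [X in _ < X]mulrC -ltr_pdivrMr //.
exact: truncn_itv.
Qed.

(** In cell j one has 1/p <= (ln p / p) / (K j), and by Mertens the sum of ln p / p over an interval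
    of logarithmic length K is at most K + [mertens_const]. *)
Lemma sum_inv_cell_le (R : realType) (K : R) (j N : nat) : 0 < K -> (0 < j)%N ->
  \sum_(0 <= p < N | prime p && (cell K p == j)) (p%:R : R)^-1
    <= (1 + mertens_const R / K) / j%:R.
Proof.
move=> K0 j0; have j0R : (0 : R) < j%:R by rewrite ltr0n.
rewrite ler_pdivlMr // -(ler_pM2l K0).
have -> : K * (1 + mertens_const R / K) = K * j.+1%:R - K * j%:R
  + mertens_const R.
  by rewrite -natr1; field; rewrite gt_eqF.
have Kj : 0 <= K * j%:R <= K * j.+1%:R.
  by rewrite (mulr_ge0 (ltW K0)) //= ler_pM2l // ler_nat.
apply: le_trans (mertens1_interval N Kj).
rewrite mulrCA mulr_suml.
apply: (@le_trans _ _ (\sum_(0 <= p < N | prime p && (cell K p == j)) ln (p%:R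
  : R) / p%:R)).
  apply: ler_sum => p /andP[pp /eqP <-]; rewrite mulrC.
  by rewrite ler_wpM2r ?invr_ge0 //; have /andP[] := cell_itv p K0.
apply: ler_sum_uniq; rewrite ?iota_uniq //.
  by move=> i _ _; rewrite divr_ge0 // ln_nat_ge0.
move=> p -> /andP[-> /eqP <-] /=.
by have /andP[-> /ltW ->] := cell_itv p K0.
Qed.

(** * Sifting the harmonic sum *)

Lemma harmonic_ge (R : realType) (n : nat) :
  ln (n.+1%:R : R) <= \sum_(1 <= k < n.+1) k%:R^-1.
Proof.
elim: n => [|n IHn]; first by rewrite ln1 big_geq.
rewrite big_nat_recr //= (le_trans (ln_succ_le R (ltn0Sn n))) //.
by rewrite lerD2r.
Qed.

(* Adjoining a prime p to s removes multiples of p; dividing these by p gives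
   distinct integers already counted for s, hence the factor 1 - 1/p. *)
Lemma harmonic_sift_ge (R : realType) (s : seq nat) (N : nat) : all prime s ->
  \prod_(p <- s) (1 - (p%:R : R)^-1) * \sum_(1 <= n < N.+1) (n%:R : R)^-1
    <= \sum_(1 <= n < N.+1 | all (fun p => ~~ (p %| n)%N) s) (n%:R : R)^-1.
Proof.
elim: s => [|p s IHs] /=; first by rewrite big_nil mul1r.
move=> /andP[pp /IHs {}IHs]; have p0 : (0 < p)%N := prime_gt0 pp.
have p1 : (1 : R) < p%:R by rewrite ltr1n prime_gt1.
rewrite big_cons -mulrA.
apply: (le_trans (ler_wpM2l _ IHs));
  first by rewrite subr_ge0 invf_le1 ?(ltW p1) // ltr0n.
set S := \sum_(_ <= n < _ | all _ s) _; rewrite mulrBl mul1r lerBlDr.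
rewrite {1}/S (bigID (fun n => (p %| n)%N)) /= addrC lerD //.
  by rewrite le_eqVlt; apply/orP; left; apply/eqP; apply: eq_bigl => n;
    rewrite andbC.
rewrite /S mulr_sumr -big_filter.
set r := [seq _ <- _ | _].
have rP n : n \in r -> [/\ all (fun q =>
  ~~ (q %| n)%N) s, (p %| n)%N & (0 < n < N.+1)%N].
  by rewrite mem_filter mem_index_iota => /andP[/andP[-> ->] ->].
have -> : \sum_(n <- r) (n%:R : R)^-1 = \sum_(m <- map (fun n =>
  n %/ p)%N r) p%:R^-1 * (m%:R)^-1.
  rewrite big_map big_seq [RHS]big_seq; apply: eq_bigr => n /rP[_ pn _].
  by rewrite -{1}(divnK pn) natrM invfM mulrC.
apply: ler_sum_uniq.
- rewrite map_inj_in_uniq ?filter_uniq ?iota_uniq //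
  => a b /rP[_ pa _] /rP[_ pb _] ab.
  by rewrite -(divnK pa) ab divnK.
- exact: iota_uniq.
- by move=> *; rewrite mulr_ge0 ?invr_ge0.
move=> m /mapP[n /rP[sn pn /andP[n0 nN]] ->] _; rewrite mem_index_iota.
rewrite divn_gt0 // dvdn_leq // (leq_ltn_trans (leq_div _ _)) //=.
apply: sub_all sn => q; apply: contra => /dvdn_trans; apply.
by rewrite -{2}(divnK pn) dvdn_mulr.
Qed.

(** * Lists of primes and their products *)

Fixpoint lists (A : Type) (s : seq A) (k : nat) : seq (seq A) :=
  if k is k'.+1 then [seq x :: l | x <- s, l <- lists s k'] else [:: [::]].

Lemma mem_lists (A : eqType) (s : seq A) (k : nat) (l : seq A) :
  (l \in lists s k) = (size l == k) && all (mem s) l.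
Proof.
elim: k l => [|k IHk] [|x l] //=.
  by apply/negP => /allpairsP[[y m] [_ _]].
apply/allpairsP/and3P => [[[y m] /= [ys ml [-> ->]]]|[sl xs al]].
  by move: ml; rewrite IHk => /andP[]; split.
by exists (x, l); split=> //=; rewrite IHk; apply/andP.
Qed.

Lemma lists_uniq (A : eqType) (s : seq A) (k : nat) :
  uniq s -> uniq (lists s k).
Proof.
move=> us; elim: k => //= k IHk; apply: allpairs_uniq => //.
by move=> [x l] [y m] _ _ [-> ->].
Qed.

Lemma size_lists (A : Type) (s : seq A) (k : nat) :
  size (lists s k) = (size s ^ k)%N.
Proof. by elim: k => //= k IHk; rewrite size_allpairs IHk expnS. Qed.

Lemma big_lists_recl (R : nmodType) (A : Type) (s : seq A) (k : nat)
    (h : seq A -> R) :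
  \sum_(l <- lists s k.+1) h l = \sum_(x <- s) \sum_(l <- lists s k) h (x :: l).
Proof. exact: big_allpairs_dep. Qed.

(** Expanding the product of the class sums gives one term per k-tuple of elements of s, attached to
    the tuple of its classes. This turns sums over tuples of cells into sums over tuples of
    primes. *)
Lemma sum_lists_fiber (R : comPzRingType) (A B : eqType) (s : seq A) (r : seq B)
    (c : A -> B) (f : A -> R) (k : nat) (h : seq B -> R) :
  uniq r -> (forall a, a \in s -> c a \in r) ->
  \sum_(bs <- lists r k) h bs * \prod_(b <- bs) \sum_(a <- s | c a == b) f a
    = \sum_(l <- lists s k) h (map c l) * \prod_(a <- l) f a.
Proof.
move=> ur cr; elim: k h => [|k IHk] h; first by rewrite /= !big_seq1 !big_nil.
rewrite !big_lists_recl.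
under eq_bigr do under eq_bigr do rewrite big_cons mulrCA.
under eq_bigr do rewrite -mulr_sumr (IHk (fun l => h (_ :: l))) mulr_suml.
under [RHS]eq_bigr do under eq_bigr do rewrite big_cons mulrCA.
under [RHS]eq_bigr do rewrite -mulr_sumr /=.
rewrite (exchange_big_dep xpredT) //= big_seq [RHS]big_seq.
apply: eq_bigr => a /cr car; rewrite -big_filter.
rewrite (_ : [seq b <- r | c a == b] = [:: c a]) ?big_seq1 //.
rewrite (eq_filter (a2 := pred1 (c a))); last by move=> b /=; rewrite eq_sym.
by rewrite filter_pred1_uniq.
Qed.

Lemma size_le_fiber (A B : eqType) (f : A -> B) (s : seq A) (n : nat) :
  (forall b, (count (fun a => f a == b) s <= n)%N) ->
  (size s <= n * size (undup (map f s)))%N.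
Proof.
move=> H; have -> : size s = (\sum_(b <- undup (map f s)) count (fun a =>
  f a == b) s)%N.
  under eq_bigr do rewrite -sum1_count big_mkcond.
  rewrite exchange_big /= -sum1_size big_seq [RHS]big_seq;
    apply: eq_bigr => a sa.
  rewrite -big_mkcond -big_filter /= (eq_filter (a2 := pred1 (f a))).
    by rewrite filter_pred1_uniq ?undup_uniq ?mem_undup ?map_f // big_seq1.
  by move=> b /=; rewrite eq_sym.
elim: (undup _) => [|b t IH]; first by rewrite big_nil.
by rewrite big_cons /= mulnS leq_add.
Qed.

Lemma prime_dvd_prod_primes (l : seq nat) (p : nat) :
  prime p -> all prime l -> (p %| \prod_(q <- l) q)%N -> p \in l.
Proof.
move=> pp; elim: l => [|q l IHl] /=.
  by rewrite big_nil dvdn1 => _ /eqP p1; rewrite p1 in pp.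
move=> /andP[qp lp]; rewrite big_cons Euclid_dvdM // inE => /orP[|/(IHl lp) ->].
  by rewrite dvdn_prime2 // => ->.
by rewrite orbT.
Qed.

(** By unique factorisation, every list with product n uses only primes of one fixed such list,
    which has at most k distinct entries; so each of the k places has at most k choices. *)
Lemma count_lists_prod (s : seq nat) (k n : nat) : uniq s -> all prime s ->
  (count (fun l => \prod_(q <- l) q == n) (lists s k) <= k ^ k)%N.
Proof.
move=> us /allP sp; rewrite -size_filter.
have [|ne] := altP ([seq l <- lists s k | \prod_(q <- l) q == n] =P [::]).
  by move=> ->.
case E : [seq _ <- _ | _] ne => [//|l0 t] _.
have lP l : l \in l0 :: t -> [/\ size l = k, all prime l,
  \prod_(q <- l) q = n & l \in lists s k].
  rewrite -E mem_filter => /andP[/eqP -> ls]; split => //.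
    by move: ls; rewrite mem_lists => /andP[/eqP].
  move: ls; rewrite mem_lists => /andP[_]; apply: sub_all => q; exact: sp.
have [sl0 pl0 nl0 _] := lP l0 (mem_head _ _).
apply: (@leq_trans (size (lists (undup l0) k))).
  apply: uniq_leq_size; first by rewrite -E filter_uniq // lists_uniq.
  move=> l /lP[sl pl nl _]; rewrite mem_lists sl eqxx; apply/allP => q ql.
  rewrite /= mem_undup; apply: prime_dvd_prod_primes => //;
    first exact: (allP pl).
  by rewrite nl0 -nl (big_rem q) //= dvdn_mulr.
rewrite size_lists; have [->|k0] := posnP k; first by rewrite !expn0.
by rewrite leq_exp2r // -sl0 size_undup.
Qed.

Lemma pnat_gt0 (pi : nat_pred) (n : nat) : pi.-nat n -> (0 < n)%N.
Proof. by case/andP. Qed.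

(** The factor m is recovered from m n as its Z-part, and then n by division, so distinct pairs give
    distinct products. *)
Lemma count_pnat_products (P Z : nat_pred) (N : nat) (M : seq nat)
    (D : nat -> seq nat) :
  uniq M -> (forall m, m \in M -> uniq (D m)) ->
  (forall m, m \in M -> P.-nat m && Z.-nat m) ->
  (forall m n, m \in M -> n \in D m ->
     [&& P.-nat n, (Z^')%N.-nat n & (m * n <= N)%N]) ->
  (\sum_(m <- M) size (D m) <= count P.-nat (iota 1 N))%N.
Proof.
move=> uM uD hM hD; rewrite -size_filter.
have -> : (\sum_(m <- M) size (D m))%N = size [seq (m * n)%N | m <- M,
  n <- D m].
  by rewrite size_allpairs_dep sumnE big_map.
have part m n : m \in M -> n \in D m -> ((m * n)`_Z = m)%N.
  move=> mM nD; have /andP[_ mZ] := hM _ mM;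
    have /and3P[nP nZ _] := hD _ _ mM nD.
  have m0 := pnat_gt0 mZ; have n0 := pnat_gt0 nP.
  by rewrite (partnM _ m0 n0) (part_pnat_id mZ) (part_p'nat nZ) muln1.
apply: uniq_leq_size.
  apply: allpairs_uniq_dep => // -[m n] [m' n'] /allpairsPdep[a [b [aM bD [->
    ->]]]].
  move=> /allpairsPdep[a' [b' [aM' bD' [-> ->]]]] /= E.
  have aa : a = a' by rewrite -(part a b) // E part.
  subst a'; have /andP[/pnat_gt0 a0 _] := hM _ aM.
  by move/eqP: E; rewrite eqn_pmul2l // => /eqP ->.
move=> y /allpairsPdep[m [n [mM nD ->]]].
have /andP[mP _] := hM _ mM; have /and3P[nP _ le] := hD _ _ mM nD.
rewrite mem_filter pnatM mP nP mem_iota add1n ltnS le andbT muln_gt0.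
by rewrite (pnat_gt0 mP) (pnat_gt0 nP).
Qed.

(** * Integrals over unions of grid cells *)

(** The cells are open so that their union is admissible as the set T of Hypothesis T; the omitted
    endpoints have measure zero. *)
Definition grid_cell (R : realType) (w : R) (j : nat) : set R :=
  `]w * j%:R, w * j.+1%:R[.

Definition grid_union (R : realType) (w : R) (G : seq nat) : set R :=
  [set t | exists2 j, j \in G & grid_cell w j t].

Lemma grid_cell_inj (R : realType) (w : R) (i j : nat) (t : R) : 0 < w ->
  grid_cell w i t -> grid_cell w j t -> i = j.
Proof.
move=> w0; rewrite /grid_cell /= !in_itv /= => /andP[i1 i2] /andP[j1 j2].
have := lt_trans i1 j2; have := lt_trans j1 i2.
rewrite !ltr_pM2l // !ltr_nat !ltnS => ji ij.
by apply/eqP; rewrite eqn_leq ij ji.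
Qed.

Lemma open_grid_union (R : realType) (w : R) (G : seq nat) :
  open (grid_union w G).
Proof.
have -> : grid_union w G = \bigcup_(j in [set` G]) grid_cell w j by [].
by apply: bigcup_open => j _; exact: interval_open.
Qed.

(* Unlike ge0_le_integral this assumes no measurability: for m > 1 the inner
   integrals of multi_integral are not known to be measurable. *)
Lemma ge0_le_integral_nomeas d (X : measurableType d) (R : realType)
    (mu : {measure set X -> \bar R}) (D : set X) (f g : X -> \bar R) :
  (forall x, D x -> (0 <= f x)%E) -> (forall x, D x -> (f x <= g x)%E) ->
  (\int[mu]_(x in D) f x <= \int[mu]_(x in D) g x)%E.
Proof.
move=> f0 fg; have g0 x : D x -> (0 <= g x)%E by move=> Dx;
  rewrite (le_trans (f0 _ Dx)) ?fg.
rewrite !ge0_integralE //= ge_ereal_sup // => _ [h /= hf] <-.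
apply: ereal_sup_ubound; exists h => // x; apply: le_trans (hf x) _.
by rewrite /patch; case: ifPn => // /set_mem /fg.
Qed.

Lemma integral_grid_step (R : realType) (w : R) (G : seq nat) (c : nat -> R) :
  0 < w -> (forall j, 0 <= c j) ->
  (\int[lebesgue_measure]_(t in grid_union w G)
     (\sum_(j <- G) c j * \1_(grid_cell w j) t)%:E)%E = (w * \sum_(j <- G) c
       j)%:E.
Proof.
move=> w0 c0; have mT := open_measurable (@open_grid_union R w G).
have mC j : measurable (grid_cell w j) by exact: measurable_itv.
under eq_integral do rewrite -sumEFin.
rewrite ge0_integral_sum //; last 2 first.
- move=> j; apply/measurable_EFinP/measurable_funM => //.
  apply: measurable_indic; exact: mC.
- by move=> j t _; rewrite lee_fin mulr_ge0.
rewrite mulr_sumr -sumEFin big_seq [RHS]big_seq; apply: eq_bigr => j jG.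
under eq_integral do rewrite EFinM.
rewrite ge0_integralZl_EFin //; last first.
  by apply/measurable_EFinP; apply: measurable_indic; exact: mC.
have -> : (\int[lebesgue_measure]_(t in grid_union w G) (\1_(grid_cell w j)
  t)%:E
    = lebesgue_measure (grid_cell w j `&` grid_union w G))%E.
  by apply: integral_indic; [exact: mT | exact: mC].
rewrite setIidl; last by move=> t; exists j.
rewrite lebesgue_measure_itv /= lte_fin ltr_pM2l // ltr_nat ltnSn.
by rewrite -EFinD -EFinM -natr1; congr (_%:E); ring.
Qed.

Lemma integral_grid_le (R : realType) (w : R) (G : seq nat) (c : nat -> R)
    (f : R -> \bar R) :
  0 < w -> (forall j, 0 <= c j) ->
  (forall t, grid_union w G t -> (0 <= f t)%E) ->
  (forall j t, j \in G -> grid_cell w j t -> (f t <= (c j)%:E)%E) ->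
  (\int[lebesgue_measure]_(t in grid_union w G) f t
    <= (w * \sum_(j <- G) c j)%:E)%E.
Proof.
move=> w0 c0 f0 fc; rewrite -integral_grid_step //.
apply: ge0_le_integral_nomeas => // t [j jG jt].
apply: (le_trans (fc _ _ jG jt)); rewrite lee_fin (big_rem j) //=.
by rewrite indicE mem_set // mulr1 lerDl sumr_ge0 // => i _; rewrite mulr_ge0.
Qed.

(** The step function must stay below f, so no cell may be counted twice: cells of different index
    are disjoint and G has no repetition, hence only one term is nonzero at each point. *)
Lemma integral_grid_ge (R : realType) (w : R) (G : seq nat) (c : nat -> R)
    (f : R -> \bar R) :
  0 < w -> uniq G -> (forall j, 0 <= c j) ->
  (forall j t, j \in G -> grid_cell w j t -> ((c j)%:E <= f t)%E) ->
  ((w * \sum_(j <- G) c j)%:E <= \int[lebesgue_measure]_(t in grid_union w G) f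
    t)%E.
Proof.
move=> w0 uG c0 cf; rewrite -integral_grid_step //.
apply: ge0_le_integral_nomeas => t [j jG jt].
  by rewrite lee_fin sumr_ge0 // => i _; rewrite mulr_ge0.
apply: le_trans (cf _ _ jG jt); rewrite lee_fin (big_rem j) //=.
rewrite indicE mem_set // mulr1 big_seq big1 ?addr0 // => i.
rewrite mem_rem_uniq // inE => /andP[ij _];
  rewrite indicE memNset ?mulr0 // => it.
by rewrite (grid_cell_inj w0 it jt) eqxx in ij.
Qed.

Fixpoint in_grid_cells (R : realType) (w : R) (ts : seq R) (js : seq nat) :
  Prop :=
  match ts, js with
  | [::], [::] => True
  | t :: ts', j :: js' => grid_cell w j t /\ in_grid_cells w ts' js'
  | _, _ => False
  end.

Lemma multi_integral_ge0 (R : realType) (D : set R) (m : nat) (f :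
  seq R -> \bar R) :
  (forall ts, {in ts, forall t, D t} -> (0 <= f ts)%E) ->
  (0 <= multi_integral D m f)%E.
Proof.
elim: m f => [|m IHm] f f0 /=; first exact: f0.
apply: integral_ge0 => t Dt; apply: IHm => ts Dts; apply: f0 => u.
by rewrite inE => /predU1P[->|/Dts].
Qed.

(** Induction on the number of variables: with the first variable in cell j, the inner integral is
    bounded through the function h(j :: -), and each integration contributes a factor w. *)
Lemma multi_integral_grid_le (R : realType) (w : R) (G : seq nat) (m : nat)
    (f : seq R -> \bar R) (h : seq nat -> R) :
  0 < w -> (forall js, 0 <= h js) ->
  (forall ts, {in ts, forall t, grid_union w G t} -> (0 <= f ts)%E) ->
  (forall ts js, {subset js <= G} -> in_grid_cells w ts js -> (f ts
    <= (h js)%:E)%E) ->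
  (multi_integral (grid_union w G) m f
    <= (w ^+ m * \sum_(js <- lists G m) h js)%:E)%E.
Proof.
move=> w0; elim: m f h => [|m IHm] f h h0 f0 fh /=.
  by rewrite big_seq1 expr0 mul1r; apply: fh.
rewrite (big_lists_recl G m h) exprS -mulrA mulr_sumr.
have f0' t : grid_union w G t -> forall ts, {in ts, forall t,
  grid_union w G t} ->
    (0 <= f (t :: ts))%E.
  by move=> Gt ts Gts; apply: f0 => u; rewrite inE => /predU1P[->|/Gts].
apply: integral_grid_le => //.
- by move=> j; rewrite mulr_ge0 ?exprn_ge0 ?(ltW w0) // sumr_ge0.
- by move=> t Gt; apply: multi_integral_ge0; exact: f0'.
move=> j t jG jt; apply: IHm => //; first by apply: f0'; exists j.
move=> ts js jsG tsjs; apply: fh => // i; rewrite inE => /predU1P[->//|].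
exact: jsG.
Qed.

Lemma in_grid_cells_bounds (R : realType) (w : R) (ts : seq R) (js : seq nat) :
  0 < w -> (forall j, j \in js -> (0 < j)%N) -> in_grid_cells w ts js ->
  [/\ w * (\sum_(j <- js) j)%:R <= \sum_(t <- ts) t,
      \sum_(t <- ts) t <= w * (\sum_(j <- js) j.+1)%:R,
      0 < \prod_(j <- js) (w * j%:R)
    & \prod_(j <- js) (w * j%:R) <= \prod_(t <- ts) t].
Proof.
move=> w0; elim: ts js => [|t ts IHts] [|j js] //= js0.
  by move=> _; rewrite !big_nil mulr0; split.
rewrite /grid_cell /= in_itv /= => -[/andP[jt tj] /IHts[]].
  by move=> i ijs; apply: js0; rewrite inE ijs orbT.
move=> sl su p0 pl; have j0 : 0 < w * j%:R.
  by rewrite mulr_gt0 // ltr0n js0 // mem_head.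
rewrite !big_cons !natrD !mulrDr; split.
- by rewrite lerD // ltW.
- by rewrite lerD // ltW.
- by rewrite mulr_gt0.
- by apply: ler_pM => //; exact: ltW.
Qed.

(* The box of cells indexed by js meets the hyperplane t_1 + ... + t_k = 1. *)
Definition straddles (R : realType) (w : R) (js : seq nat) : bool :=
  (w * (\sum_(j <- js) j)%:R < 1 < w * (\sum_(j <- js) j.+1)%:R).

(** Only k - 1 coordinates are integrated, so a box has volume w^(k-1), while the integrand is at
    most the product of k factors 1/(w j); this leaves w^-1. Boxes that miss the hyperplane
    contribute nothing. *)
Lemma simplex_integral_grid_le (R : realType) (w : R) (G : seq nat) (k : nat) :
  0 < w -> (forall j, j \in G -> (0 < j)%N) -> (0 < k)%N ->
  (simplex_integral (grid_union w G) k <=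
    (w^-1 * \sum_(js <- lists G k | straddles w js)
       \prod_(j <- js) (j%:R : R)^-1)%:E)%E.
Proof.
move=> w0 G0; case: k => // k _.
have T0 t : grid_union w G t -> 0 < t.
  move=> [j jG]; rewrite /grid_cell /= in_itv /= => /andP[+ _];
    apply: le_lt_trans.
  by rewrite mulr_ge0 // ltW.
pose g (js : seq nat) := \prod_(i <- js) (w * i%:R)^-1.
have g0 js : 0 <= g js.
  by apply: prodr_ge0 => i _; rewrite invr_ge0 mulr_ge0 // ltW.
(* The box of the first k - 1 coordinates does not determine the cell j of t_k, so all possible j
   are summed. Placing j in front is harmless: [straddles] and [g] are symmetric in the indices. *)
pose h js := \sum_(j <- G | straddles w (j :: js)) g (j :: js).
apply: (@le_trans _ _ (w ^+ k * \sum_(js <- lists G k) h js)%:E).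
  apply: multi_integral_grid_le => //.
  - by move=> js; rewrite /h sumr_ge0.
  - move=> ts Tts; rewrite /simplex_integrand; case: ifPn => // /set_mem /T0 tk.
    rewrite lee_fin invr_ge0 mulr_ge0 ?(ltW tk) // big_seq prodr_ge0 //
      => t /Tts.
    by move=> /T0 /ltW.
  move=> ts js jsG tsjs; rewrite /simplex_integrand;
    case: ifPn => [/set_mem [j jG]|_]; last first.
    by rewrite lee_fin /h sumr_ge0.
  set tk := 1 - _; rewrite /grid_cell /= in_itv /= => /andP[jt tj].
  have [sl su p0 pl] := in_grid_cells_bounds w0 (fun j jjs =>
    G0 j (jsG j jjs)) tsjs.
  have st : straddles w (j :: js).
    rewrite /straddles !big_cons !natrD !mulrDr.
    by move: jt tj; rewrite /tk => jt tj; apply/andP; split; lra.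
  rewrite lee_fin /h big_mkcond (big_rem j) //= st.
  apply: (@le_trans _ _ (g (j :: js))); last first.
    by rewrite lerDl sumr_ge0 // => i _; case: ifP.
  have j0 : 0 < w * j%:R by rewrite mulr_gt0 // ltr0n G0.
  have tk0 : 0 < tk := lt_trans j0 jt.
  have ts0 : 0 < \prod_(t <- ts) t := lt_le_trans p0 pl.
  rewrite /g prodfV big_cons mulrC lef_pV2 ?posrE ?(mulr_gt0 j0) ?(mulr_gt0
    tk0) //.
  by apply: ler_pM; rewrite ?(ltW j0) ?(ltW p0) ?(ltW jt).
rewrite lee_fin [X in _ <= _ * X]big_mkcond big_lists_recl exchange_big /=
  mulr_sumr.
under eq_bigr do rewrite /h.
rewrite [in leRHS]mulr_sumr.
rewrite big_seq [leRHS]big_seq; apply: ler_sum => js jsG.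
rewrite /h big_mkcond !mulr_sumr; apply: ler_sum => j _; case: ifP => // _;
  last first.
  by rewrite !mulr0.
rewrite /g prodfV big_split /= big_const_seq count_predT iter_mulr_1 /=.
move: jsG; rewrite mem_lists => /andP[/eqP-> _].
rewrite prodfV invfM mulrA exprS invfM mulrCA mulfV ?mulr1 //.
by rewrite expf_neq0 // gt_eqF.
Qed.

Lemma log_measure_grid_ge (R : realType) (w : R) (G : seq nat) :
  0 < w -> uniq G ->
  ((\sum_(j <- G) (j.+1%:R : R)^-1)%:E <= log_measure (grid_union w G))%E.
Proof.
move=> w0 uG.
have -> : \sum_(j <- G) (j.+1%:R : R)^-1 = w * \sum_(j <- G) (w * j.+1%:R)^-1.
  rewrite mulr_sumr; apply: eq_bigr => j _.
  by rewrite invfM mulrA mulfV ?gt_eqF // mul1r.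
apply: integral_grid_ge => //.
  by move=> j; rewrite invr_ge0 mulr_ge0 // ltW.
move=> j t _; rewrite /grid_cell /= in_itv /= => /andP[jt tj].
have t0 : 0 < t by rewrite (le_lt_trans _ jt) // mulr_ge0 // ltW.
by rewrite lee_fin lef_pV2 ?posrE ?(ltW tj) // mulr_gt0.
Qed.

(** * From Hypothesis T to products of primes *)

(* The loss is at most 19 delta: 2 delta for the first cell, 16 delta for the
   cells from J1 on, and delta for the cells carrying too few primes. *)
Lemma good_cells_mass (R : realType) (eps delta W : R) (s : nat -> R)
    (J0 J1 J2 : nat) :
  0 < eps <= 1 -> delta = eps / 100 -> 0 < W ->
  (forall j, (0 < j)%N -> s j <= (1 + delta) / j%:R) ->
  delta^-1 <= J0.-1%:R -> (J0 <= J1 <= J2.+1)%N ->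
  J1%:R <= W * J0%:R -> J2.+1%:R - J1%:R <= 8 * delta * J1%:R ->
  1 + eps <= \sum_(J0.-1 <= j < J2.+1) s j ->
  1 + eps / 2 <=
    \sum_(j <- index_iota J0 J1 | delta / W / j%:R <= s j) (j.+1%:R : R)^-1.
Proof.
move=> /andP[e0 e1] dE W0 sle J0d /andP[J01 J12] J1W J2d total.
have d0 : 0 < delta by rewrite dE; lra.
have d1 : delta <= 1 / 100 by rewrite dE; lra.
have J0p : (1 : R) <= J0.-1%:R.
  by apply: le_trans J0d; rewrite invf_ge1 // (le_trans d1) //; lra.
have J0pn : (0 < J0.-1)%N by rewrite -(ltr0n R); lra.
have J0n : (0 < J0)%N by case: (J0) J0pn.
have J1n : (0 < J1)%N := leq_trans J0n J01.
have H1 : s J0.-1 <= 2 * delta.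
  apply: (le_trans (sle _ J0pn)); apply: ler_pM;
    rewrite ?invr_ge0 ?addr_ge0 ?(ltW d0) //; first by lra.
  by rewrite -[leRHS]invrK lef_pV2 ?posrE ?invr_gt0 // ltr0n.
have H2 : \sum_(J1 <= j < J2.+1) s j <= 16 * delta.
  apply: (@le_trans _ _ (\sum_(J1 <= j < J2.+1) 2 / J1%:R)).
    rewrite !big_nat; apply: ler_sum => j /andP[J1j _].
    have j0 := leq_trans J1n J1j.
    apply: (le_trans (sle _ j0)); apply: ler_pM;
      rewrite ?invr_ge0 ?addr_ge0 ?(ltW d0) //; first by lra.
    by rewrite lef_pV2 ?posrE ?ltr0n // ler_nat.
  rewrite sumr_const_nat -[_ *+ _]mulr_natl natrB //
    mulrA ler_pdivrMr ?ltr0n //; lra.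
have H3 : \sum_(J0 <= j < J1 | ~~ (delta / W / j%:R <= s j)) s j <= delta.
  apply: (@le_trans _ _ (\sum_(J0 <= j < J1) delta / W / J0%:R)).
    rewrite big_mkcond !big_nat; apply: ler_sum => j /andP[J0j _].
    have dW : 0 <= delta / W by rewrite divr_ge0 // ltW.
    case: ifPn => [|_]; last by rewrite divr_ge0.
    rewrite -ltNge => /ltW /le_trans; apply; rewrite ler_wpM2l //.
    by rewrite lef_pV2 ?posrE ?ltr0n ?(leq_trans J0n J0j) // ler_nat.
  rewrite sumr_const_nat -[_ *+ _]mulr_natl.
  apply: (@le_trans _ _ (W * J0%:R * (delta / W / J0%:R))).
    apply: ler_wpM2r; first by rewrite !divr_ge0 // ltW.
    by apply: le_trans J1W; rewrite ler_nat leq_subr.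
  rewrite le_eqVlt; apply/orP; left; apply/eqP; field.
  by rewrite !gt_eqF ?ltr0n.
have H4 : 1 + eps - 19 * delta <=
    \sum_(j <- index_iota J0 J1 | delta / W / j%:R <= s j) s j.
  move: total; rewrite (big_cat_nat (n := J0)) ?leq_pred //=;
    last exact: leq_trans J12.
  rewrite (_ : \sum_(J0.-1 <= i < J0) s i = s J0.-1); last first.
    by rewrite -{2}(prednK J0n) big_nat1.
  rewrite (big_cat_nat (n := J1)) //=.
  rewrite (bigID (fun j => delta / W / j%:R <= s j)) /=.
  by move: H1 H2 H3; lra.
(* Here s_j <= (1 + delta)/j, (1 - delta)^2 (1 + delta) <= 1 - delta, and 1 - delta <= j/(j + 1)
   because delta j >= 1. *)
have H5 : (1 - delta) ^+ 2 *
    \sum_(j <- index_iota J0 J1 | delta / W / j%:R <= s j) s j <=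
    \sum_(j <- index_iota J0 J1 | delta / W / j%:R <= s j) (j.+1%:R : R)^-1.
  rewrite mulr_sumr big_seq_cond [leRHS]big_seq_cond; apply: ler_sum => j.
  rewrite mem_index_iota => /andP[/andP[J0j _] _].
  have j0 := leq_trans J0n J0j; have j0R : (0 : R) < j%:R by rewrite ltr0n.
  have jd : 1 <= delta * j%:R.
    rewrite mulrC -ler_pdivrMr // mul1r (le_trans J0d) // ler_nat.
    exact: leq_trans (leq_pred _) J0j.
  apply: (@le_trans _ _ ((1 - delta) ^+ 2 * ((1 + delta) / j%:R))).
    by apply: ler_wpM2l; [rewrite sqr_ge0 | exact: sle].
  rewrite mulrA ler_pdivrMr // [leRHS]mulrC ler_pdivlMr ?ltr0n // -natr1.
  have : (1 - delta) ^+ 2 * (1 + delta) <= 1 - delta by nra.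
  by move: jd; set u := _ ^+ 2 * _; nra.
(* With eps = 100 delta the claim is (1 - delta)^2 (1 + 81 delta) >= 1 + 50 delta. *)
apply: le_trans H5.
apply: (le_trans _ (ler_wpM2l _ H4)); last by rewrite sqr_ge0.
by rewrite dE; nra.
Qed.

(** Replacing ln q by the lower end of its cell costs at most K per prime, and straddling places l
    within the same total error. *)
Lemma straddles_ln_prod (R : realType) (K l : R) (qs : seq nat) :
  0 < K -> 0 < l -> all prime qs -> straddles (K / l) (map (cell K) qs) ->
  l - K * (size qs)%:R <= ln ((\prod_(q <- qs) q)%:R :
    R) <= l + K * (size qs)%:R.
Proof.
move=> K0 l0 pq; rewrite /straddles !big_map => /andP[].
rewrite mulrAC ltr_pdivrMr // mul1r mulrAC ltr_pdivlMr // mul1r => lo hi.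
have E : (\sum_(q <- qs) (cell K q).+1 = \sum_(q <- qs) cell K q + size qs)%N.
  under eq_bigr do rewrite -addn1.
  by rewrite big_split /= sum1_size.
have -> : ln ((\prod_(q <- qs) q)%:R : R) = \sum_(q <- qs) ln q%:R.
  rewrite natr_prod big_seq [RHS]big_seq ln_prod // => q qqs.
  by rewrite ltr0n prime_gt0 // (allP pq).
have B : K * (\sum_(q <- qs) cell K q)%:R <= \sum_(q <- qs) ln (q%:R : R)
    <= K * (\sum_(q <- qs) (cell K q).+1)%:R.
  rewrite !natr_sum !mulr_sumr; apply/andP; split; apply: ler_sum => q _.
    by have /andP[] := cell_itv q K0.
  by have /andP[_ /ltW] := cell_itv q K0.
by move: B hi; rewrite E natrD mulrDr => /andP[B1 B2] hi; apply/andP; split;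
  lra.
Qed.

(** The integral bounds below the sum of prod 1/j over straddling tuples of cells. Each eta/j is at
    most the reciprocal mass of its cell, and expanding gives a sum of 1/(q_1 ... q_k) over
    straddling tuples of primes, each term being at most e^(-(l - K k)). *)
Lemma count_straddling_ge (R : realType) (K l eta tau : R) (G Q : seq nat) (k :
  nat) :
  0 < K -> 0 < l -> 0 < eta -> 0 <= tau -> (0 < k)%N ->
  uniq G -> (forall j, j \in G -> (0 < j)%N) ->
  all prime Q -> (forall q, q \in Q -> cell K q \in G) ->
  (forall j, j \in G ->
     eta / j%:R <= \sum_(q <- Q | cell K q == j) (q%:R : R)^-1) ->
  (tau%:E <= simplex_integral (grid_union (K / l) G) k)%E ->
  tau * (K / l) * eta ^+ k * expR (l - K * k%:R) <=
    (count (fun qs => straddles (K / l) (map (cell K) qs)) (lists Q k))%:R.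
Proof.
move=> K0 l0 eta0 tau0 k0 uG G0 pQ QG good tauI.
have w0 : 0 < K / l by rewrite divr_gt0.
set st := fun qs => straddles (K / l) (map (cell K) qs).
have H1 : tau * (K / l) <= \sum_(js <- lists G k | straddles (K / l) js)
    \prod_(j <- js) (j%:R : R)^-1.
  have := le_trans tauI (simplex_integral_grid_le w0 G0 k0).
  by rewrite lee_fin ler_pdivlMl // mulrC.
have H2 : tau * (K / l) * eta ^+ k <= \sum_(js <- lists G k)
    (straddles (K / l) js)%:R *
      \prod_(j <- js) \sum_(q <- Q | cell K q == j) (q%:R : R)^-1.
  apply: (le_trans (ler_wpM2r _ H1)); first by rewrite exprn_ge0 // ltW.
  rewrite mulr_suml big_mkcond big_seq [leRHS]big_seq; apply: ler_sum => js.
  rewrite mem_lists => /andP[/eqP sk /allP jsG]; case: ifP => _;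
    last by rewrite mul0r.
  have -> : eta ^+ k = \prod_(j <- js) eta.
    by rewrite big_const_seq count_predT iter_mulr_1 sk.
  rewrite mul1r -big_split /= big_seq [leRHS]big_seq;
    apply: ler_prod => j /jsG jG.
  by rewrite mulrC good // andbT divr_ge0 // ltW.
rewrite (sum_lists_fiber (fun q => (q%:R : R)^-1) k (fun js =>
  (straddles (K / l) js)%:R) uG QG) in H2.
rewrite -ler_pdivlMr ?expR_gt0 // -expRN; apply: (le_trans H2).
rewrite -sum1_count natr_sum mulr_suml [leRHS]big_mkcond big_seq [leRHS]big_seq.
apply: ler_sum => qs; rewrite mem_lists => /andP[/eqP sk /allP qsQ].
rewrite /st; case: ifPn => st_qs; last by rewrite mul0r.
have pq : all prime qs by apply/allP => q /qsQ; exact: (allP pQ).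
have /andP[lo _] := straddles_ln_prod K0 l0 pq st_qs.
have p0 : 0 < (\prod_(q <- qs) q)%:R :> R.
  rewrite natr_prod big_seq prodr_gt0 // => q qqs.
  by rewrite ltr0n prime_gt0 // (allP pq).
rewrite !mul1r prodfV -natr_prod expRN lef_pV2 ?posrE ?expR_gt0 //.
by rewrite -[leRHS]lnK // ler_expR -sk.
Qed.

(** * Integers composed of primes in good cells *)

Lemma expe_ge1 (R : realType) (a : \bar R) (k : nat) :
  (1 <= a)%E -> (1 <= a ^+ k)%E.
Proof.
move=> a1; elim: k => [|k IHk]; first by rewrite expe0.
by rewrite expeS -[leLHS]mul1e; apply: lee_pmul.
Qed.

(* The grid has mesh K / ln X, where X = x / (m e^(K W)): a product of at most
   W primes lying in cells that straddle ln X is within a factor e^(K W) of X,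
   hence at most x / m. *)
Lemma prime_products_ge (R : realType) (lambda3 : R) (tau : R -> R)
    (x K L W v eta : R) (P : nat_pred) (G Q : seq nat) (m : nat) :
  hypothesisT lambda3 tau -> 0 < x -> L = ln x ->
  0 < K -> 1 <= v -> W = expR 1 * v -> 0 < eta <= 1 ->
  (0 < m)%N -> ln (m%:R : R) + K * W < L ->
  uniq G -> (forall j, j \in G -> L < W * (K * j%:R)) ->
  (forall j, j \in G -> ln (m%:R : R) + K * W + K * j.+1%:R <= L) ->
  1 + lambda3 <= \sum_(j <- G) (j.+1%:R : R)^-1 -> 0 < lambda3 ->
  uniq Q -> all prime Q -> {in Q, forall q, q \in P} ->
  (forall q, q \in Q -> cell K q \in G) ->
  (forall j, j \in G ->
     eta / j%:R <= \sum_(q <- Q | cell K q == j) (q%:R : R)^-1) ->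
  exists D : seq nat, [/\ uniq D,
    (forall n, n \in D -> [/\ P.-nat n, (forall q,
      prime q -> (q %| n)%N -> q \in Q)
        & (m * n <= Num.truncn x)%N])
    & tau v * K * expR (- (2 * K * W)) * eta `^ W * W `^ (- W) * (x / L) / m%:R
        <= (size D)%:R].
Proof.
move=> [tau0 HT] x0 LE K0 v1 WE /andP[eta0 eta1] m0 mL uG Glo Ghi mass lam0 uQ
  pQ QP QG good.
have m0R : (0 : R) < m%:R by rewrite ltr0n.
have W0 : 0 < W by rewrite WE mulr_gt0 ?expR_gt0 // (lt_le_trans ltr01).
have W1 : 1 <= W.
  rewrite WE -[leLHS]mulr1 ler_pM // (le_trans _ (expR_ge1Dx 1)) //; lra.
have KW0 : 0 < K * W by rewrite mulr_gt0.
set l := L - ln (m%:R : R) - K * W.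
have l0 : 0 < l by rewrite /l; lra.
have lL : l <= L by have := ln_nat_ge0 R m; rewrite /l; lra.
have w0 : 0 < K / l by rewrite divr_gt0.
have L0 : 0 < L := lt_le_trans l0 lL.
have tau0v : 0 < tau v := tau0 v v1.
have G0 j : j \in G -> (0 < j)%N.
  by case: j => // /Glo; rewrite !mulr0 ltNge (ltW L0).
have Tsub : grid_union (K / l) G `<=` `](expR 1 * v)^-1, 1^-1[.
  move=> t [j jG]; rewrite /grid_cell /= !in_itv /= invr1 -WE => /andP[jt tj].
  apply/andP; split.
    apply: le_lt_trans jt; rewrite mulrAC ler_pdivlMr // ler_pdivrMl //.
    by apply: (le_trans lL); exact: ltW (Glo _ jG).
  apply: (lt_le_trans tj); rewrite mulrAC ler_pdivrMr // mul1r /l.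
  by have := Ghi _ jG; lra.
have logT : ((1 + lambda3)%:E <= log_measure (grid_union (K / l) G))%E.
  by apply: le_trans (log_measure_grid_ge w0 uG); rewrite lee_fin.
have := HT 1 v _ (lexx 1) v1 (@open_grid_union R (K / l) G) Tsub.
rewrite divr1 => /(_ logT)[k [k1 kW tauI]].
have k0 : (0 < k)%N by rewrite -(ler1n R).
rewrite -WE in kW.
have tauI' : ((tau v)%:E <= simplex_integral (grid_union (K / l) G) k)%E.
  apply: le_trans tauI; rewrite -[leLHS]mule1; apply: lee_wpmul2l.
    by rewrite lee_fin ltW.
  apply: expe_ge1; apply: le_trans logT; rewrite lee_fin lerDl; exact: ltW.
have := count_straddling_ge K0 l0 eta0 (ltW tau0v) k0 uG G0 pQ QG good tauI'.
set st := fun qs => _ => H1.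
pose S := [seq qs <- lists Q k | st qs].
pose pr (qs : seq nat) := (\prod_(q <- qs) q)%N.
exists (undup (map pr S)); split; first exact: undup_uniq.
  move=> n; rewrite mem_undup => /mapP[qs]; rewrite mem_filter mem_lists.
  move=> /andP[sqs /andP[/eqP sk /allP qsQ]] ->.
  have pq : all prime qs by apply/allP => q /qsQ; exact: (allP pQ).
  have pr0 : (0 < pr qs)%N.
    by rewrite /pr big_seq prodn_cond_gt0 // => q /(allP pq)/prime_gt0.
  have dv q : prime q -> (q %| pr qs)%N -> q \in Q.
    by move=> qp /(prime_dvd_prod_primes qp pq)/qsQ.
  split => //.
    by apply/pnatP => // q qp /(dv _ qp) /QP.
  rewrite truncn_ge_nat ?(ltW x0) // natrM -[leRHS]lnK //
    -[leLHS]lnK ?posrE ?mulr_gt0 ?ltr0n //.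
  rewrite ler_expR lnM ?posrE ?ltr0n // -LE.
  have /andP[_ hi] := straddles_ln_prod K0 l0 pq sqs.
  have : K * (size qs)%:R <= K * W by rewrite ler_pM2l // sk.
  by move: hi; rewrite /l /pr; lra.
(* Different tuples may have the same product; each product comes from at most k^k of them. *)
have H2 : (size S <= k ^ k * size (undup (map pr S)))%N.
  apply: size_le_fiber => n; apply: leq_trans (count_lists_prod k n uQ pQ).
  rewrite count_filter; apply: sub_count => qs /= /andP[].
  by [].
have kk0 : 0 < (k%:R : R) ^+ k by rewrite exprn_gt0 // ltr0n.
have H3 : tau v * (K / l) * eta ^+ k * expR (l - K * k%:R) / k%:R ^+ k
    <= (size (undup (map pr S)))%:R.
  rewrite ler_pdivrMr // -natrX -natrM mulnC.
  by apply: (le_trans H1); rewrite -size_filter ler_nat.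
apply: le_trans H3.
(* Hypothesis T only says that some k in [1, W] works; [E1], [E2] and [E3] replace k by W in each
   factor. *)
have E1 : expR (- (2 * K * W)) * x / m%:R <= expR (l - K * k%:R).
  rewrite -{1}[x]lnK // -[m%:R]lnK // -LE -expRN -!expRD ler_expR /l.
  have : K * k%:R <= K * W by rewrite ler_pM2l.
  lra.
have E2 : eta `^ W <= eta ^+ k.
  by rewrite -powR_mulrn ?(ltW eta0) // ger_powR // eta0.
have E3 : W `^ (- W) <= (k%:R ^+ k)^-1.
  rewrite powRN lef_pV2 ?posrE ?powR_gt0 //.
  apply: (@le_trans _ _ (W ^+ k)); first by rewrite lerXn2r ?nnegrE ?(ltW W0).
  by rewrite -powR_mulrn ?(ltW W0) // ler_powR.
have E4 : K / L <= K / l by rewrite ler_pM2l // lef_pV2.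
have -> : tau v * K * expR (- (2 * K * W)) * eta `^ W * W `^ (- W) * (x / L) /
  m%:R
  = tau v * (K / L) * eta `^ W * (expR (- (2 * K * W)) * x / m%:R) * W `^ (- W).
  by field; rewrite !gt_eqF.
have p1 : 0 <= expR (- (2 * K * W)) * x / m%:R.
  by rewrite !mulr_ge0 ?expR_ge0 ?invr_ge0 // ltW.
have p2 : 0 <= K / L by rewrite divr_ge0 // ltW.
have p3 : 0 <= tau v * (K / L) by rewrite mulr_ge0 // ltW.
have p4 : 0 <= tau v * (K / L) * eta `^ W by rewrite mulr_ge0 // powR_ge0.
apply: ler_pM => //; [by rewrite mulr_ge0 | by rewrite powR_ge0 |].
apply: ler_pM => //; apply: ler_pM => //; first by rewrite powR_ge0.
by rewrite ler_pM2l.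
Qed.

(** J is the cell of ln x / W and J2 that of ln x. J1 leaves room below ln x for a factor m <=
    x^(delta/W) and for the rounding loss e^(K W). The assumption 3 K W <= delta L makes K small
    against L/W, so all rounding to whole cells is negligible. *)
Lemma cell_cutoffs (R : realType) (K L W delta : R) :
  0 < delta <= 1 / 100 -> 0 < K -> 2 <= W -> 0 < L -> 3 * K * W <= delta * L ->
  let J := Num.truncn (L / W / K) in
  let J1 := Num.truncn ((L - delta * (L / W) - K * W) / K) in
  let J2 := Num.truncn (L / K) in
  [/\ L / W < K * J.+1%:R, K * J1%:R <= L - delta * (L / W) - K * W,
      delta^-1 <= J%:R, (J < J1 <= J2.+1)%N
    & J1%:R <= W * J.+1%:R /\ J2.+1%:R - J1%:R <= 8 * delta * J1%:R].
Proof.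
move=> /andP[d0 d1] K0 W2 L0 KW J J1 J2.
have W0 : 0 < W by lra.
have LW0 : 0 < L / W by rewrite divr_gt0.
have LW2 : L / W <= L / 2 by rewrite ler_pM2l // lef_pV2 ?posrE.
have LWE : L / W * W = L by rewrite divfK // gt_eqF.
have KdL : 3 * K <= delta * (L / W) by rewrite mulrA ler_pdivlMr.
have KW0 : 0 < K * W by rewrite mulr_gt0.
have dL1 : delta * L <= L / 100 by nra.
have dLW : delta * (L / W) <= delta * L / 2 by rewrite -mulrA ler_pM2l.
have /andP[Jl Ju] : K * J%:R <= L / W < K * J.+1%:R.
  have /andP[a b] : J%:R <= L / W / K < J.+1%:R.
    by apply: truncn_itv; rewrite divr_ge0 // ltW.
  by rewrite mulrC -ler_pdivlMr // a /= [X in _ < X]mulrC -ltr_pdivrMr.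
have num0 : 0 <= L - delta * (L / W) - K * W by lra.
have /andP[J1l J1u] : K * J1%:R <= L - delta * (L / W) - K * W < K * J1.+1%:R.
  have /andP[a b] : J1%:R <= (L - delta * (L / W) - K * W) / K < J1.+1%:R.
    by apply: truncn_itv; rewrite divr_ge0 // ltW.
  by rewrite mulrC -ler_pdivlMr // a /= [X in _ < X]mulrC -ltr_pdivrMr.
have /andP[J2l J2u] : K * J2%:R <= L < K * J2.+1%:R.
  have /andP[a b] : J2%:R <= L / K < J2.+1%:R by apply: truncn_itv;
    rewrite divr_ge0 // ltW.
  by rewrite mulrC -ler_pdivlMr // a /= [X in _ < X]mulrC -ltr_pdivrMr.
have K1 : K <= K * W by rewrite ler_peMr ?(ltW K0) //; lra.
have Ju1 : L / W < K * J%:R + K by move: Ju; rewrite -natr1 mulrDr mulr1.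
have J1u1 : L - delta * (L / W) - K * W < K * J1%:R + K.
  by move: J1u; rewrite -[J1.+1%:R]natr1 mulrDr mulr1.
have J2u1 : K * J2.+1%:R <= L + K by rewrite -natr1 mulrDr mulr1 lerD2r.
(* Then K (J2 + 1 - J1) <= delta L/W + K W + 2 K <= 2 delta L, whereas 8 delta K J1 >= 4 delta L. *)
have KJ1 : K * J1%:R >= L / 2 by lra.
split => //.
- rewrite -(ler_pM2l K0) ler_pdivrMr //; nra.
- apply/andP; split.
    rewrite -(ltr_nat R) -(ltr_pM2l K0); lra.
  rewrite -(ler_nat R) -(ler_pM2l K0); lra.
- split; first by rewrite -(ler_pM2l K0) mulrCA; nra.
  by rewrite -(ler_pM2l K0) mulrBr mulrCA; nra.
Qed.

(** Each m yields at least a constant times x/(m L) integers; the sifted sum of 1/m is at least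
    delta L/W times the product over E, so L cancels and the last factor delta/W remains. *)
Lemma Psi_ge_of_hypothesisT (R : realType) (eps delta K : R) (tau : R -> R)
    (x v W L : R) (P : nat_pred) :
  0 < eps <= 1 -> delta = eps / 100 -> K = mertens_const R / delta ->
  hypothesisT (eps / 2) tau ->
  2 <= x -> (forall p : nat, p \in P -> prime p /\ p%:R <= x) ->
  1 <= v -> W = expR 1 * v -> L = ln x -> 3 * K * W <= delta * L ->
  1 + eps <= \sum_(0 <= p < (Num.truncn x).+1 | (p \in P) && (x `^ W^-1 < p%:R))
               (p%:R : R)^-1 ->
  tau v * K * expR (- (2 * K * W)) * (delta / W) `^ W * W `^ (- W) * (delta /
    W) *
    \prod_(0 <= p < (Num.truncn x).+1 | p \in excluded_primes x P) (1 - (p%:R :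
      R)^-1)
  <= (Psi x P)%:R / x.
Proof.
move=> /andP[e0 e1] dE KE HT x2 Pprime v1 WE LE KW total.
have d0 : 0 < delta by rewrite dE; lra.
have d1 : delta <= 1 / 100 by rewrite dE; lra.
have K0 : 0 < K by rewrite KE divr_gt0 // mertens_const_gt0.
have W2 : 2 <= W.
  by rewrite WE -[leLHS]mulr1 ler_pM // (le_trans _ (expR_ge1Dx 1)).
have W0 : 0 < W by lra.
have x0 : 0 < x by lra.
have L0 : 0 < L by rewrite LE ln_gt0 //; lra.
have LW0 : 0 < L / W by rewrite divr_gt0.
have LWE : L / W * W = L by rewrite divfK // gt_eqF.
have LW1 : L / W <= L by rewrite ler_pdivrMr // ler_peMr ?(ltW L0) //; lra.
have KW0 : 0 < K * W by rewrite mulr_gt0.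
have dL1 : delta * L <= L / 100 by rewrite mulrC ler_pM2l // -div1r.
have dLW : delta * (L / W) <= delta * L by rewrite ler_pM2l.
set N := Num.truncn x in total *.
pose J := Num.truncn (L / W / K).
pose J1 := Num.truncn ((L - delta * (L / W) - K * W) / K).
pose J2 := Num.truncn (L / K).
have d01 : 0 < delta <= 1 / 100 by rewrite d0.
have [Ju J1l Jd J12 [J1W J2d]] := cell_cutoffs d01 K0 W2 L0 KW.
rewrite -/J -/J1 -/J2 in Ju J1l Jd J12 J1W J2d.
pose Q0 := [seq p <- index_iota 0 N.+1 | p \in P].
pose s j := \sum_(q <- Q0 | cell K q == j) (q%:R : R)^-1.
have Q0P q : q \in Q0 -> [/\ prime q, q \in P & q%:R <= x].
  by rewrite mem_filter => /andP[qP _]; have [] := Pprime q qP.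
have sle j : (0 < j)%N -> s j <= (1 + delta) / j%:R.
  move=> j0; have -> : delta = mertens_const R / K.
    by rewrite KE invf_div mulrCA mulfV ?mulr1 // gt_eqF // mertens_const_gt0.
  apply: le_trans (sum_inv_cell_le N.+1 K0 j0); apply: ler_sum_uniq.
  - by rewrite filter_uniq // iota_uniq.
  - exact: iota_uniq.
  - by move=> *; rewrite invr_ge0.
  move=> q /[dup] /Q0P[qp _ _]; rewrite mem_filter => /andP[_ ->] ->.
  by rewrite qp.
(* Cell J may contain x^(1/W) in its interior, so it must be counted in the total; the good cells
   start only at J + 1. *)
have cellP p : p \in P -> x `^ W^-1 < p%:R -> (J <= cell K p < J2.+1)%N.
  move=> pP xp; have [pp px] := Pprime p pP.
  have p0 : (0 : R) < p%:R by rewrite ltr0n prime_gt0.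
  have lp : ln (p%:R : R) <= L by rewrite LE ler_ln.
  have lp2 : L / W <= ln (p%:R : R).
    by rewrite LE mulrC -ln_powR ler_ln ?posrE ?powR_gt0 // ltW.
  by rewrite ltnS !le_truncn // ler_pM2r ?invr_gt0.
have tot : 1 + eps <= \sum_(J <= j < J2.+1) s j.
  apply: (le_trans total); rewrite /s (exchange_big_dep xpredT) //=.
  rewrite /Q0 big_filter big_mkcondr; apply: ler_sum => p pP.
  case: ifPn => [xp|_]; last by rewrite sumr_ge0.
  rewrite -big_filter (eq_filter (a2 := pred1 (cell K p))); last by move=> j;
    rewrite /= eq_sym.
  rewrite filter_pred1_uniq ?iota_uniq ?big_seq1 // mem_index_iota.
  exact: cellP.
have mass : 1 + eps / 2 <=
    \sum_(j <- index_iota J.+1 J1 | delta / W / j%:R <= s j) (j.+1%:R : R)^-1.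
  by apply: (@good_cells_mass _ _ _ _ s _ _ J2 _ dE) => //; rewrite ?e0.
pose G := [seq j <- index_iota J.+1 J1 | delta / W / j%:R <= s j].
have GP j : j \in G -> (J < j < J1)%N /\ delta / W / j%:R <= s j.
  by rewrite mem_filter mem_index_iota => /andP[-> ->].
pose Q := [seq q <- Q0 | cell K q \in G].
pose zN := Num.truncn (expR (delta * (L / W))).
pose E := [seq p <- index_iota 0 N.+1 | p \in excluded_primes x P].
(* Since zN <= x, an integer up to zN without prime factor in E has all its prime factors in P. *)
pose M := [seq m <- index_iota 1 zN.+1 | all (fun p => ~~ (p %| m)%N) E].
pose B := tau v * K * expR (- (2 * K * W)) * (delta / W) `^ W * W `^ (- W).
have lnz m : (0 < m)%N -> (m <= zN)%N -> ln (m%:R : R) <= delta * (L / W).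
  move=> m0; rewrite truncn_ge_nat ?expR_ge0 // => mz.
  by rewrite -[leRHS]expRK ler_ln ?posrE ?ltr0n ?expR_gt0.
have MP m : m \in M -> [/\ (0 < m)%N, (m <= zN)%N & all (fun p =>
  ~~ (p %| m)%N) E].
  by rewrite mem_filter mem_index_iota => /andP[-> /andP[-> +]].
have QP q : q \in Q -> [/\ prime q, q \in P & cell K q \in G].
  by rewrite mem_filter => /andP[-> /Q0P[-> -> _]].
(* Outside M the list takes the arbitrary value [[::]]. *)
have /choice[D HD] : forall m : nat, exists D : seq nat, m \in M ->
   [/\ uniq D,
    (forall n, n \in D -> [/\ P.-nat n, (forall q,
      prime q -> (q %| n)%N -> q \in Q)
        & (m * n <= N)%N])
    & B * (x / L) / m%:R <= (size D)%:R].
  move=> m; have [/MP[m0 mz _]|] := boolP (m \in M); last by exists [::].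
  have lm := lnz m m0 mz.
  have [D HD] : exists D : seq nat, [/\ uniq D,
    (forall n, n \in D -> [/\ P.-nat n, (forall q,
      prime q -> (q %| n)%N -> q \in Q)
        & (m * n <= N)%N])
    & B * (x / L) / m%:R <= (size D)%:R]; last by exists D.
  apply: (@prime_products_ge _ (eps / 2) tau x K L W v (delta / W) P G Q m) =>
    //.
  - by rewrite divr_gt0 //= ler_pdivrMr //; lra.
  - lra.
  - by rewrite filter_uniq // iota_uniq.
  - move=> j /GP[/andP[Jj _] _]; rewrite -LWE mulrC ltr_pM2l //.
    by apply: (lt_le_trans Ju); rewrite ler_pM2l // ler_nat.
  - move=> j /GP[/andP[_ jJ1] _].
    have : K * j.+1%:R <= K * J1%:R by rewrite ler_pM2l // ler_nat.
    by move: J1l lm; lra.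
  - by rewrite big_filter.
  - lra.
  - by rewrite !filter_uniq // iota_uniq.
  - by apply/allP => q /QP[].
  - by move=> q /QP[].
  - by move=> q /QP[].
  move=> j jG; have [_ /le_trans] := GP j jG; apply.
  rewrite le_eqVlt; apply/orP; left; apply/eqP.
  rewrite /s /Q [RHS]big_filter_cond; apply: eq_bigl => q.
  by case: eqP => [->|_]; rewrite ?jG ?andbF.
(* Z separates the two factors: primes of m are at most zN, primes of n exceed it. *)
pose Z := [pred p : nat | (p <= zN)%N].
have count : (\sum_(m <- M) size (D m) <= Psi x P)%N.
  apply: (@count_pnat_products P Z).
  - by rewrite filter_uniq // iota_uniq.
  - by move=> m /HD[].
  - move=> m /MP[m0 mz /allP mE]; apply/andP; split; apply/pnatP => // p pp pm;
    last first.
      by rewrite inE (leq_trans _ mz) // dvdn_leq.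
    apply: contraT => pP; have : ~~ (p %| m)%N; last by rewrite pm.
    have px : p%:R <= x.
      apply: (@le_trans _ _ m%:R); first by rewrite ler_nat dvdn_leq.
      rewrite -[leRHS]lnK // -[leLHS]lnK ?posrE ?ltr0n // ler_expR -LE.
      by apply: (le_trans (lnz m m0 mz)); lra.
    apply: mE; rewrite mem_filter inE pp px pP /= mem_index_iota ltnS.
    by rewrite truncn_ge_nat // ltW.
  move=> m n mM nD; have [_ /(_ n nD)[nP nQ ->] _] := HD m mM.
  rewrite nP andbT /=; apply/pnatP; first by case/andP: nP.
  (* A prime q of a good cell has ln q >= K (J + 1) > L/W, whereas every positive integer up to zN
     has logarithm at most delta L/W. *)
  move=> q qp /(nQ q qp)/QP[_ _ /GP[/andP[Jq _] _]]; rewrite !inE -ltnNge.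
  rewrite ltnNge; apply/negP => /(lnz q (prime_gt0 qp)).
  have /andP[+ _] := cell_itv q K0.
  have : K * J.+1%:R <= K * (cell K q)%:R by rewrite ler_pM2l // ler_nat.
  by move: Ju; nra.
have B0 : 0 <= B.
  have [tau0 _] := HT; rewrite /B !mulr_ge0 ?powR_ge0 ?expR_ge0 ?(ltW K0) //.
  exact: ltW (tau0 v v1).
have sift : \prod_(p <- E) (1 - (p%:R :
  R)^-1) * (delta * (L / W)) <= \sum_(m <- M) (m%:R : R)^-1.
  have pE : all prime E by apply/allP => p;
    rewrite mem_filter inE => /andP[/and3P[]].
  rewrite /M [leRHS]big_filter; apply: le_trans (harmonic_sift_ge R zN pE).
  apply: ler_wpM2l.
    rewrite big_seq prodr_ge0 // => p /(allP pE) pp.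
    by rewrite subr_ge0 invf_le1 ?ltr0n ?ler1n prime_gt0.
  (* The harmonic sum up to zN is at least ln(zN + 1), so rounding x^(delta/W) down to zN costs
     nothing. *)
  apply: le_trans (harmonic_ge R zN).
  by rewrite -[leLHS]expRK ler_ln ?posrE ?expR_gt0 ?ltr0n // ltW // truncnS_gt.
rewrite ler_pdivlMr // -big_filter -/E.
apply: (@le_trans _ _ (B * (x / L) * \sum_(m <- M) (m%:R : R)^-1)); last first.
  apply: (@le_trans _ _ (\sum_(m <- M) size (D m))%:R); last by rewrite ler_nat.
  rewrite natr_sum mulr_sumr big_seq [leRHS]big_seq;
    apply: ler_sum => m /HD[_ _].
  by [].
have xL : 0 <= B * (x / L) by rewrite mulr_ge0 // divr_ge0 // ltW.
apply: le_trans (ler_wpM2l xL sift).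
rewrite le_eqVlt; apply/orP; left; apply/eqP; rewrite -/B.
by field; rewrite !gt_eqF.
Qed.

(** Every factor is the exponential of -O(v + v ln v + 1). The linear term is absorbed by v <= e + v
    ln v, and passing from v = max(v0, 1) to v0 costs a constant: v ln v <= v0 ln v0 + 1, because ln
    v0 > -1. *)
Lemma v_pow_lower_bound (R : realType) (K delta c0 C0 : R) :
  0 < K -> 0 < delta <= 1 -> 0 < c0 -> 0 < C0 ->
  exists A C : R, 0 < C /\ forall v0 v W tauv : R,
    v = Num.max v0 1 -> W = expR 1 * v -> 0 < v0 -> 1 < expR 1 * v0 ->
    c0 * v `^ (- (C0 * v)) <= tauv ->
    K * c0 * delta * expR (- A) * v0 `^ (- (C * v0)) <=
    tauv * K * expR (- (2 * K * W)) * (delta / W) `^ W * W `^ (- W) *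
      (delta / W).
Proof.
move=> K0 /andP[d0 d1] c00 C00.
have [e eE] : {e : R | e = expR 1} by exists (expR 1).
have e2 : 2 <= e by rewrite eE (le_trans _ (expR_ge1Dx 1)).
have e_gt0 : 0 < e by lra.
have lne : ln e = 1 by rewrite eE expRK.
(* The coefficient of v in minus the exponent, once W = e v and ln W = 1 + ln v are inserted. *)
pose a := e * (2 * K - ln delta + 2).
have a0 : 0 <= a.
  have : ln delta <= 0 by rewrite ln_le0.
  by move=> ld; rewrite mulr_ge0 //; lra.
(* In C, a comes from v <= e + t, 2 e + C0 is the coefficient of t = v ln v, and 1 comes from ln v
   <= t. In A, a e is the rest of the first bound, 1 comes from ln W, and C from t <= v0 ln v0 +
   1. *)
pose C := a + 2 * e + C0 + 1; pose A := a * e + 1 + C.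
exists A, C; split; first by rewrite /C; lra.
move=> v0 v W tauv vE; rewrite -eE => WE v0_gt0 ev0 tauE.
have v1 : 1 <= v by rewrite vE le_max lexx orbT.
have v_gt0 : 0 < v by lra.
have W0 : 0 < W by rewrite WE mulr_gt0.
have dW0 : 0 < delta / W by rewrite divr_gt0.
apply: (@le_trans _ _ (c0 * v `^ (- (C0 * v)) * K * expR (- (2 * K * W)) *
    (delta / W) `^ W * W `^ (- W) * (delta / W))); last first.
  by rewrite !ler_pM2r ?powR_gt0 ?expR_gt0.
have powE (b y : R) : 0 < b -> b `^ y = expR (y * ln b).
  by move=> b0; rewrite /powR gt_eqF.
have WVE : W^-1 = expR (- ln W) by rewrite expRN lnK.
rewrite !powE // ln_div ?posrE // WVE.
set ld := ln delta.
have -> : c0 * expR (- (C0 * v) * ln v) * K * expR (- (2 * K * W)) *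
    expR (W * (ld - ln W)) * expR (- W * ln W) * (delta * expR (- ln W)) =
  K * c0 * delta * expR (- (C0 * v) * ln v + - (2 * K * W) + W * (ld - ln W)
    + - W * ln W + - ln W).
  by rewrite !expRD; ring.
rewrite -mulrA -expRD ler_pM2l ?mulr_gt0 // ler_expR.
have lnW : ln W = 1 + ln v by rewrite WE lnM ?posrE ?lne.
rewrite lnW.
have lv0 : 0 <= ln v by rewrite ln_ge0.
pose t := v * ln v.
have lnv_t : ln v <= t by rewrite ler_peMl.
have v_t : v <= e + t.
  have [ve|ev] := leP v e; first by have : 0 <= t by [rewrite mulr_ge0 // ltW];
    lra.
  have : 1 <= ln v by rewrite -lne ler_ln ?posrE ?(ltW ev) //; lra.
  by rewrite -(ler_pM2l v_gt0) mulr1 -/t; lra.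
have t_le : t <= v0 * ln v0 + 1.
  rewrite /t vE; case: (leP v0 1) => v01; last by rewrite lerDl.
  rewrite ln1 mulr0.
  have : - 1 <= ln v0.
    have : 0 <= ln (e * v0) by rewrite ln_ge0 // ltW.
    by rewrite lnM ?posrE ?lne //; lra.
  by nra.
have main : a * v + (2 * e + C0) * t + 1 + ln v <= A + C * (v0 * ln v0).
  have h1 : a * v <= a * (e + t) by rewrite ler_wpM2l.
  have C_ge0 : 0 <= C by rewrite /C; lra.
  have h2 : C * t <= C * (v0 * ln v0 + 1) by rewrite ler_wpM2l.
  by move: h1 h2; rewrite /A /C; lra.
have -> : - (C0 * v) * ln v + - (2 * K * W) + W * (ld - (1 + ln v))
  + - W * (1 + ln v) + - (1 + ln v)
   = - (a * v + (2 * e + C0) * t + 1 + ln v).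
  by rewrite /a /t WE /ld; ring.
by move: main; lra.
Qed.

Theorem proposition1 (R : realType)
    (hypT : forall lambda3 : R, 0 < lambda3 ->
       exists tau : R -> R, hypothesisT lambda3 tau /\ v_pow_negOv tau) :
  forall eps : R, 0 < eps ->
  exists c c1 C : R, [/\ 0 < c, 0 < c1, 0 < C &
    forall (x : R) (P : nat_pred), 2 <= x ->
      (forall p : nat, p \in P -> prime p /\ p%:R <= x) ->
      forall v : R, 0 < v -> v <= c * Num.sqrt (ln x) ->
        1 + eps <= \sum_(0 <= p < (Num.truncn x).+1
                          | (p \in P) && (x `^ (expR 1 * v)^-1 < p%:R))
                     (p%:R : R)^-1 ->
        c1 * v `^ (- (C * v)) *
          \prod_(0 <= p < (Num.truncn x).+1 | p \in excluded_primes x P)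
             (1 - (p%:R : R)^-1)
        <= (Psi x P)%:R / x].
Proof.
(* Lowering eps to at most 1 weakens the assumption on the sum, and keeps delta <= 1/100. *)
move=> eps0 eps0_gt0; pose eps := Num.min eps0 1.
have eps_itv : 0 < eps <= 1 by rewrite /eps lt_min eps0_gt0 ltr01 ge_min lexx
  orbT.
have eps_le : eps <= eps0 by rewrite /eps ge_min lexx.
have /andP[e0 e1] := eps_itv.
have [tau [HT [c0 [C0 [c00 C00 tauE]]]]] := hypT (eps / 2) (divr_gt0 e0 (ltr0Sn
  R 1)).
have [delta dE] : {d | d = eps / 100} by exists (eps / 100).
have [K KE] : {K | K = mertens_const R / delta}
  by exists (mertens_const R / delta).
have d0 : 0 < delta by rewrite dE; lra.
have d1 : delta <= 1 by rewrite dE; lra.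
have d01 : 0 < delta <= 1 by rewrite d0.
have K0 : 0 < K by rewrite KE divr_gt0 // mertens_const_gt0.
have [A [C [C_gt0 constE]]] := v_pow_lower_bound K0 d01 c00 C00.
have [e eE] : {e : R | e = expR 1} by exists (expR 1).
have e2 : 2 <= e by rewrite eE (le_trans _ (expR_ge1Dx 1)).
have e_gt0 : 0 < e by lra.
have lne : ln e = 1 by rewrite eE expRK.
(* This c satisfies c <= 1 and 3 K e^3 c^2 <= delta, which is what 3 K W <= delta ln x requires
   below. *)
pose c := delta / (delta + 3 * K * e ^+ 3).
have e30 : 0 < 3 * K * e ^+ 3 by rewrite !mulr_gt0 ?exprn_gt0.
have den0 : 0 < delta + 3 * K * e ^+ 3 by rewrite addr_gt0.
have c_gt0 : 0 < c by rewrite divr_gt0.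
have c_le1 : c <= 1 by rewrite ler_pdivrMr // mul1r lerDl ltW.
have c_sq : 3 * K * e ^+ 3 * c ^+ 2 <= delta.
  have cE : c * (delta + 3 * K * e ^+ 3) = delta by rewrite divfK // gt_eqF.
  have : c ^+ 2 <= c by rewrite expr2 ler_piMr // ltW.
  by move: cE; nra.
clearbody c.
exists c, (K * c0 * delta * expR (- A)), C; split => //;
  first by rewrite !mulr_gt0 ?expR_gt0.
move=> x P x2 Pprime v0 v0_gt0 v0c; rewrite -eE => total.
set L := ln x in v0c *.
have x0 : 0 < x by lra.
have L0 : 0 < L by rewrite ln_gt0 //; lra.
set r := Num.sqrt L in v0c.
have r0 : 0 < r by rewrite sqrtr_gt0.
have rL : r ^+ 2 = L by rewrite sqr_sqrtr // ltW.
(* Otherwise x^(1/(e v0)) >= x and the sum over P is empty. *)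
have ev0 : 1 < e * v0.
  rewrite ltNge; apply/negP => ev1; move: total.
  rewrite big1 => [|p /andP[pP]]; first lra.
  rewrite ltNge => /negP[]; have [_ px] := Pprime p pP.
  apply: (le_trans px); apply: le1r_powR; first lra.
  by rewrite invf_ge1 // mulr_gt0 //; lra.
pose v := Num.max v0 1; pose W := e * v.
have WE : W = expR 1 * v by rewrite /W eE.
have v1 : 1 <= v by rewrite /v le_max lexx orbT.
have v0v : v0 <= v by rewrite /v le_max lexx.
have vev0 : v <= e * v0.
  by rewrite /v ge_max (ltW ev0) andbT ler_peMl //; lra.
(* From 1 < e v0 <= e c r, where r^2 = L, one gets W <= e^2 c r; multiplying by e c r >= 1 gives W
   <= e^3 c^2 L. *)
have KW : 3 * K * W <= delta * L.
  have h1 : 1 <= e * c * r by rewrite -mulrA; apply: le_trans (ltW ev0) _;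
    rewrite ler_pM2l //; lra.
  have h2 : W <= e * (e * (c * r)).
    rewrite /W ler_pM2l; last lra.
    by apply: (le_trans vev0); rewrite ler_pM2l //; lra.
  apply: (@le_trans _ _ (3 * K * (e * (e * (c * r)))));
    first by rewrite ler_pM2l // mulr_gt0.
  apply: (@le_trans _ _ (3 * K * (e * (e * (c * r))) * (e * c * r))).
    by rewrite ler_peMr // !mulr_ge0 ?(ltW K0) ?(ltW c_gt0) ?(ltW r0) //; lra.
  have -> : 3 * K * (e * (e * (c * r))) * (e * c * r) = 3 * K * e ^+ 3 * c ^+ 2
    * r ^+ 2 by ring.
  by rewrite rL ler_pM2r.
(* Raising v0 to v lowers the threshold x^(1/W), so the sum can only grow. *)
have total' : 1 + eps <= \sum_(0 <= p < (Num.truncn x).+1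
    | (p \in P) && (x `^ W^-1 < p%:R)) (p%:R : R)^-1.
  apply: (@le_trans _ _ (1 + eps0)); first by rewrite lerD2l.
  apply: (le_trans total); apply: ler_sum_uniq; rewrite ?iota_uniq //.
  move=> p -> /andP[-> xp] /=; apply: le_lt_trans xp; apply: ler_powR;
    first lra.
  by rewrite lef_pV2 ?posrE ?mulr_gt0 ?ler_pM2l //; lra.
have := Psi_ge_of_hypothesisT eps_itv dE KE HT x2 Pprime v1 WE erefl KW total'.
apply: le_trans; apply: ler_wpM2r.
  apply: prodr_ge0 => p; rewrite inE => /andP[pp _].
  by rewrite subr_ge0 invf_le1 ?ltr0n ?ler1n prime_gt0.
apply: (constE v0 v W) => //; first by rewrite -eE.
exact: tauE.
Qed.
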